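(* Let $r\ge1$, let $\mathcal O\subset\mathfrak p$ be a $p$-distinguished nilpotent $H$-orbit for the balanced CII pair $(\mathrm{Sp}_{4r},\mathrm{Sp}_{2r}\times\mathrm{Sp}_{2r})$, and let $$e=x_A=\begin{pmatrix}0& A\\ A&0\end{pmatrix}\in\mathcal O,\qquad A^*=-A,$$ be a $\tau$-fixed representative, where $A\in\mathfrak{sp}(V)$ is nilpotent with pairwise distinct even Jordan block sizes $n_1>\cdots>n_s>0$, $\sum_in_i=2r$. Then the Zariski closure of $H_e^\circ\cdot(\mathfrak p^e)^\tau$ is $$\overline{H_e^\circ\cdot(\mathfrak p^e)^\tau}^{\,\mathrm{Zar}}=\mathfrak p^e.$$ Moreover, the image of $$H_e^\circ\times(\mathfrak p^e)^\tau\longrightarrow\mathfrak p^e,\qquad(h,x)\longmapsto h\cdot x,$$ contains a nonempty Euclidean open subset of $\mathfrak p^e$.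
   Context: Let $V$ be a complex symplectic space of dimension $2r$; for $C\in\operatorname{End}(V)$, $C^*$ denotes the symplectic adjoint. Let $U,W$ be two copies of $V$ (identified by a symplectic isomorphism $j:U\to W$), $E=U\oplus W$ with the orthogonal sum symplectic form, $G=\mathrm{Sp}(E)$, $H=\mathrm{Sp}(U)\times\mathrm{Sp}(W)$, $\theta=\operatorname{Ad}(s)$ with $s=\mathrm{Id}_U\oplus(-\mathrm{Id}_W)$. The $(-1)$-eigenspace of $d\theta$ in $\mathfrak{sp}(E)$ is $$\mathfrak p=\left\{x_C=\begin{pmatrix}0&C\\ -C^*&0\end{pmatrix}:C\in\operatorname{End}(V)\right\}.$$ The block swap is $\tau(u,w)=(w,u)$ on $E=V\oplus V$; it acts on $\mathfrak p$ by conjugation, i.e. $x_C\mapsto x_{-C^*}$, and normalizes $H$. For $e\in\mathfrak p$: $\mathfrak p^e=\{x\in\mathfrak p:[x,e]=0\}$, $H_e$ is the stabilizer of $e$ in $H$ and $H_e^\circ$ its identity component; $(\mathfrak p^e)^\tau$ is the $\tau$-fixed subspace. A nilpotent $e\in\mathfrak p$ (and its $H$-orbit) is $p$-distinguished if every element of $\mathfrak p^e$ is nilpotent. *)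

(* Defs.v *)
From HB Require Import structures.
From mathcomp Require Import all_boot all_order all_algebra.
From mathcomp Require Import all_classical all_reals all_analysis.
From mathcomp Require Import complex.
(* Not imported: its notations clash with those of mathcomp-analysis. *)
From mathcomp Require mpoly.

Set Implicit Arguments.
Unset Strict Implicit.
Unset Printing Implicit Defensive.

Import Order.TTheory GRing.Theory Num.Theory.
Import numFieldNormedType.Exports.
Local Open Scope classical_set_scope.
Local Open Scope ring_scope.

(* The complex numbers, as a structure rather than the bare type [R[i]], so
   that matrices over them get the (Euclidean) topology which
   mathcomp-analysis attaches to every [numFieldType]. *)
Definition Cplx (R : realType) : numClosedFieldType := R[i].

(* V is K^n (column vectors, on which matrices act from the left) with the
   form of Gram matrix Om:  omega(v, w) = v^T Om w. *)
Section Symplectic.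
Variables (K : numFieldType) (n : nat).
Implicit Types (Om C X g : 'M[K]_n) (v w : 'cV[K]_n).

(* In characteristic 0, antisymmetric and alternating forms coincide. *)
Definition symplectic_form Om : Prop := Om^T = - Om /\ Om \in unitmx.

Definition form Om v w : K := (v^T *m Om *m w) 0 0.

(* The symplectic adjoint C^*, see [sadjP] and [sadj_unique]. *)
Definition sadj Om C : 'M[K]_n := invmx Om *m C^T *m Om.

Definition Sp Om : set 'M[K]_n := [set g | g^T *m Om *m g = Om].

Definition sp Om : set 'M[K]_n := [set X | sadj Om X = - X].

Definition Ad g X : 'M[K]_n := g *m X *m invmx g.

Definition nilpotent X : Prop := exists k : nat, X ^+ k = 0.

Lemma sadjP Om C v w :
  symplectic_form Om -> form Om (C *m v) w = form Om v (sadj Om C *m w).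
Proof.
by move=> [_ Omu]; rewrite /form /sadj trmx_mul !mulmxA mulmxK.
Qed.

Lemma form_inj Om C D : symplectic_form Om ->
  (forall v w, form Om v (C *m w) = form Om v (D *m w)) -> C = D.
Proof.
move=> [_ Omu] eqCD.
suff eqO : Om *m C = Om *m D by rewrite -(mulKmx Omu C) eqO mulKmx.
apply/matrixP => i j; have := eqCD (delta_mx i 0) (delta_mx j 0).
have mE (M : 'M[K]_n) : ((delta_mx i 0 : 'cV_n)^T *m M *m delta_mx j 0) 0 0 = M i j.
  rewrite trmx_delta -rowE mxE (bigD1 j) //= big1 => [|k kj].
    by rewrite addr0 !mxE !eqxx mulr1.
  by rewrite !mxE (negbTE kj) mulr0.
by rewrite /form !mulmxA -!(mulmxA _ Om) !mE.
Qed.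

Lemma sadj_unique Om C D : symplectic_form Om ->
  (forall v w, form Om (C *m v) w = form Om v (D *m w)) -> D = sadj Om C.
Proof.
by move=> OmS eqCD; apply: (form_inj OmS) => v w; rewrite -eqCD sadjP.
Qed.

Lemma spP Om X : symplectic_form Om ->
  sp Om X <-> forall v w, form Om (X *m v) w + form Om v (X *m w) = 0.
Proof.
move=> OmS; have mN (M : 'M[K]_1) : (- M) 0 0 = - M 0 0 by rewrite mxE.
split=> [spX v w|X0].
  rewrite sadjP // [sadj _ _]spX /form mulNmx mulmxN mN.
  by rewrite addrC subrr.
rewrite /sp /=; apply/esym/sadj_unique => // v w.
apply/eqP; rewrite -subr_eq0 -(X0 v w) /form mulNmx mulmxN.
by rewrite mN opprK.
Qed.

End Symplectic.

(* The nilpotent Jordan block of size n (ones on the superdiagonal). *)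
Definition jordan_block (K : numFieldType) (n : nat) : 'M[K]_n :=
  \matrix_(i < n, j < n) (j == i.+1 :> nat)%:R.

(* A is nilpotent with Jordan blocks of sizes ns 0, ..., ns (s - 1); the base
   change is rectangular, with explicit inverse Q, to avoid a cast along
   \sum_i ns i = m. *)
Definition nilpotent_jordan_type (K : numFieldType) (m : nat) (A : 'M[K]_m)
    (s : nat) (ns : 'I_s -> nat) : Prop :=
  exists (P : 'M[K]_(m, \sum_i ns i)) (Q : 'M[K]_(\sum_i ns i, m)),
    [/\ P *m Q = 1%:M, Q *m P = 1%:M &
        A = P *m (\mxdiag_i jordan_block K (ns i)) *m Q].

(* Zariski topology of the affine space of m x n matrices: polynomials in the
   entries, a closed set being the zero locus of a family of polynomials. *)
Section Zariski.
Variables (K : numFieldType) (m n : nat).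

Definition mxeval (X : 'M[K]_(m, n)) (p : mpoly.mpoly (m * n) K) : K :=
  mpoly.meval (fun k => mxvec X 0 k) p.

Definition zariski_closed (Z : set 'M[K]_(m, n)) : Prop :=
  exists I : set (mpoly.mpoly (m * n) K),
    Z = [set X | forall p, I p -> mxeval X p = 0].

Definition zariski_closure (S : set 'M[K]_(m, n)) : set 'M[K]_(m, n) :=
  smallest zariski_closed S.

End Zariski.

(* The symmetric pair (Sp(E), Sp(U) x Sp(W)) for E = U (+) W, where U and W are
   both identified with V = (K^n, Om). *)
Section SymmetricPair.
Variables (K : numFieldType) (n : nat) (Om : 'M[K]_n).
Implicit Types (e x h : 'M[K]_(n + n)) (C : 'M[K]_n).

Definition sumform : 'M[K]_(n + n) := block_mx Om 0 0 Om.

Definition invol : 'M[K]_(n + n) := block_mx 1%:M 0 0 (- 1%:M).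

Definition HH : set 'M[K]_(n + n) :=
  [set block_mx g 0 0 h | g in Sp Om & h in Sp Om].

(* The (-1)-eigenspace, in the Lie algebra of Sp(E), of the differential of
   Ad(s); see [ppE]. *)
Definition pp : set 'M[K]_(n + n) :=
  [set x | sp sumform x /\ Ad invol x = - x].

Definition pmx C : 'M[K]_(n + n) := block_mx 0 C (- sadj Om C) 0.

Definition block_swap : 'M[K]_(n + n) := block_mx 0 1%:M 1%:M 0.

Definition pcent e : set 'M[K]_(n + n) :=
  [set x | pp x /\ x *m e - e *m x = 0].

Definition pcent_tau e : set 'M[K]_(n + n) :=
  [set x | pcent e x /\ Ad block_swap x = x].

Definition Hstab e : set 'M[K]_(n + n) := [set h | HH h /\ Ad h e = e].

(* Identity component for the Euclidean topology. As H_e is a complex algebraic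
   group, it is also the identity component for the Zariski topology. *)
Definition Hstab0 e : set 'M[K]_(n + n) :=
  connected_component (Hstab e) 1%:M.

Definition Horbit e : set 'M[K]_(n + n) := [set Ad h e | h in HH].

Definition p_distinguished e : Prop :=
  [/\ pp e, nilpotent e & forall x, pcent e x -> nilpotent x].

Definition p_distinguished_orbit (O : set 'M[K]_(n + n)) : Prop :=
  exists2 e, p_distinguished e & O = Horbit e.

(* The image of (h, x) |-> h . x on H_e^o x (p^e)^tau. *)
Definition tau_sweep e : set 'M[K]_(n + n) :=
  [set Ad h x | h in Hstab0 e & x in pcent_tau e].

Lemma invol_sqr : invol *m invol = 1%:M.
Proof.
rewrite /invol mulmx_block !(mulmx0, mul0mx, addr0, add0r, mulmx1).
by rewrite mulmxN mulmx1 opprK -scalar_mx_block.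
Qed.

Lemma block_swap_sqr : block_swap *m block_swap = 1%:M.
Proof.
rewrite /block_swap mulmx_block !(mulmx0, mul0mx, addr0, add0r, mulmx1).
by rewrite -scalar_mx_block.
Qed.

Lemma sqr_inv (g : 'M[K]_(n + n)) : g *m g = 1%:M -> invmx g = g.
Proof.
by move=> gg; have [gu _] := mulmx1_unit gg; rewrite -[RHS](mulKmx gu) gg mulmx1.
Qed.

Lemma sumform_symplectic : symplectic_form Om -> symplectic_form sumform.
Proof.
move=> [skO Omu]; split.
  by rewrite /sumform tr_block_mx skO !trmx0 opp_block_mx !oppr0.
by rewrite unitmxE /sumform det_ublock unitrM -!unitmxE Omu.
Qed.

Lemma sumform_inv : symplectic_form Om ->
  invmx sumform = block_mx (invmx Om) 0 0 (invmx Om).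
Proof.
move=> OmS; have [_ Fu] := sumform_symplectic OmS; have [_ Omu] := OmS.
apply: (can_inj (mulKmx Fu)); rewrite mulmxV // /sumform mulmx_block.
by rewrite !(mulmx0, mul0mx, addr0, add0r) mulmxV // -scalar_mx_block.
Qed.

Lemma sadjK C : symplectic_form Om -> sadj Om (sadj Om C) = C.
Proof.
move=> [skO Omu]; rewrite /sadj !trmx_mul trmxK trmx_inv skO.
have -> : invmx (- Om) = - invmx Om.
  have Nu : - Om \in unitmx by rewrite -scaleN1r unitmxZ ?unitrN1.
  apply: (can_inj (mulKmx Nu)); rewrite mulmxV // mulmxN mulNmx opprK.
  by rewrite mulmxV.
rewrite !(mulmxN, mulNmx) opprK !mulmxA mulVmx // mul1mx.
by rewrite -mulmxA mulVmx // mulmx1.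
Qed.

Lemma ppE : symplectic_form Om -> pp = range pmx.
Proof.
move=> OmS; have [skO Omu] := OmS.
have sE a b c d : sadj sumform (block_mx a b c d) =
    block_mx (sadj Om a) (sadj Om c) (sadj Om b) (sadj Om d).
  rewrite /sadj sumform_inv // /sumform tr_block_mx !mulmx_block.
  by rewrite !(mulmx0, mul0mx, addr0, add0r).
have iE a b c d : Ad invol (block_mx a b c d) = block_mx a (- b) (- c) d.
  rewrite /Ad (sqr_inv invol_sqr) /invol !mulmx_block.
  by rewrite !(mulmx0, mul0mx, addr0, add0r, mulmx1, mul1mx, mulmxN, mulNmx, opprK).
apply/seteqP; split=> x.
  rewrite -[x]submxK => -[]; rewrite /sp /= sE iE !opp_block_mx.
  move=> /eq_block_mx[_ _ sb _] /eq_block_mx[a0 _ _ d0].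
  have z (a : 'M[K]_n) : a = - a -> a = 0.
    move/eqP; rewrite -subr_eq0 opprK -mulr2n -scaler_nat scaler_eq0.
    by rewrite pnatr_eq0 /= => /eqP.
  exists (ursubmx x) => //; rewrite /pmx (z _ a0) (z _ d0).
  by rewrite sb opprK.
move=> [C _ <-]; split; rewrite /sp /pmx /= ?sE ?iE !opp_block_mx.
  have sN D : sadj Om (- D) = - sadj Om D.
    by rewrite /sadj linearN /= mulmxN mulNmx.
  by rewrite sN sadjK // /sadj trmx0 !(mulmx0, mul0mx) !oppr0 opprK.
by rewrite !oppr0.
Qed.

Lemma Ad_block_swap C : symplectic_form Om ->
  Ad block_swap (pmx C) = pmx (- sadj Om C).
Proof.
move=> OmS; rewrite /Ad (sqr_inv block_swap_sqr) /block_swap /pmx !mulmx_block.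
rewrite !(mulmx0, mul0mx, addr0, add0r, mulmx1, mul1mx).
have -> : sadj Om (- sadj Om C) = - sadj Om (sadj Om C).
  by rewrite /sadj linearN /= mulmxN mulNmx.
by rewrite sadjK // opprK.
Qed.

End SymmetricPair.

(* Main.v *)
From HB Require Import structures.
Require Import Defs.
From mathcomp Require Import all_boot all_order all_algebra.
From mathcomp Require Import all_classical all_reals all_analysis.
From mathcomp Require Import complex zify ring lra.
From mathcomp Require mpoly.
Import (canonicals) mpoly.

Set Implicit Arguments.
Unset Strict Implicit.
Unset Printing Implicit Defensive.

Import Order.TTheory GRing.Theory Num.Theory.
Import numFieldNormedType.Exports.
Local Open Scope classical_set_scope.
Local Open Scope ring_scope.

(** Write adj for the symplectic adjoint and C = S + T with adj S = - S and
    adj T = T. Then x_C centralizes e = x_A exactly when S commutes and T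
    anticommutes with A, and x_C is tau-fixed exactly when T = 0. If g is
    symplectic with g A = A g^-1, then h = diag(g, g^-1) stabilizes e and acts
    by C |-> g C g. Taking g = 1 + Q + ... with Q skew-adjoint and
    anticommuting with A, the orbit map at a tau-fixed point x_S moves in the
    directions Q S + S Q. The theorem therefore follows once some S makes
    Q |-> Q S + S Q a map onto the space of all T.

    Surjectivity is a dimension count ([anticomm_onto]). The operator
    X |-> X A + A X exchanges skew-adjoint and self-adjoint X and is symmetric
    for the trace form, so its two restrictions have the same rank; hence the
    space of the Q exceeds that of the T by at least
    dim sp(V) - dim (self-adjoint) = dim V ([dim_sadjv_anticomm],
    [dim_sadjv]). On the other hand, if a vector v generates V under A and S,
    then a Q anticommuting with both is determined by Q v, so the kernel of
    Q |-> Q S + S Q has dimension at most dim V.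

    To find such an S, let X map the generator of each Jordan block of A to
    the generator of the next smaller one. Because the sizes strictly
    decrease, X kills ker A; so the image of adj X lies in A V, and
    S = X - adj X induces the same shift as X on V / A V. The generator of the
    largest block then generates V by Nakayama's lemma
    ([jordan_shift_cyclic], [regular_centralizing_element]).

    The passage from tangent directions to an open set is explicit. With
    g = (1 + P) / (1 - P) and Q = 2 P / (1 + P^2), so that
    g^2 = (1 + Q) / (1 - Q), the matrix g^-1 (S + T) g^-1 is skew-adjoint as
    soon as Q S + S Q = T + Q T Q ([cayley_translate_skew]). For S near the
    chosen one and T small, a contraction solves this equation for Q
    ([anticomm_quadratic_near]) and a second one recovers P from Q
    ([cayley_half]). The path t |-> Cayley transform of t P joins 1 to g, so h
    lies in the identity component ([cayley_Hstab0]).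

    Finally p^e is a linear space, hence Zariski closed, and a polynomial that
    vanishes on a nonempty open part of it vanishes on it, by restriction to
    lines ([vspace_zariski_closed], [mxeval_vanish]). *)

(** * A shift between Jordan blocks *)

Section JordanShift.
Variables (K : numFieldType) (s : nat) (ns : 'I_s -> nat).
Hypothesis ns_decr : forall i j : 'I_s, (i < j)%N -> (ns j < ns i)%N.

Let J := \mxdiag_i jordan_block K (ns i).

(** Within a block the nilpotent matrix sends the basis vector b to b - 1, so
    the generator of a block is its last vector. The block (j.+1, j) aligns
    these last vectors when d = 0; for d = 1, the vector b goes where b + 1 goes
    for d = 0. *)
Definition shift_block (d : nat) (i j : 'I_s) : 'M[K]_(ns i, ns j) :=
  \matrix_(a, b) ((i == j.+1 :> nat) && (a + ns j == b + d + ns i))%N%:R.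

Definition jordan_shift (d : nat) := \mxblock_(i, j) shift_block d i j.

Lemma jordan_block_mulE n p (M : 'M[K]_(n, p)) a b :
  (jordan_block K n *m M) a b = \sum_(c < n | c == a.+1 :> nat) M c b.
Proof.
rewrite mxE [RHS]big_mkcond; apply: eq_bigr => c _.
by rewrite mxE; case: eqP; rewrite (mul1r, mul0r).
Qed.

Lemma mul_jordan_blockE n p (M : 'M[K]_(p, n)) a b :
  (M *m jordan_block K n) a b = \sum_(c < n | b == c.+1 :> nat) M a c.
Proof.
rewrite mxE [RHS]big_mkcond; apply: eq_bigr => c _.
by rewrite mxE; case: eqP; rewrite (mulr1, mulr0).
Qed.

(** Both products send the vector b of block j to the vector aligned with b - 1
    in block j.+1; at the ends of the blocks the strict decrease of the sizes
    makes both of them vanish. *)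
Lemma jordan_shift_comm : J *m jordan_shift 0 = jordan_shift 0 *m J.
Proof.
rewrite /J /jordan_shift mul_mxdiag_mxblock mul_mxblock_mxdiag.
apply/eq_mxblock => i j; apply/matrixP => a b.
rewrite jordan_block_mulE mul_jordan_blockE.
under eq_bigr do rewrite mxE; under [RHS]eq_bigr do rewrite mxE.
have [ij|nij] := boolP (i == j.+1 :> nat); last by rewrite !big1.
have ns_lt : (ns i < ns j)%N by apply: ns_decr; rewrite (eqP ij).
have [a_lt|a_ge] := ltnP a.+1 (ns i).
  rewrite (big_pred1 (Ordinal a_lt)) /=; last by move=> c; rewrite /= -val_eqE.
  have [b0|b_gt0] := posnP b.
    rewrite big1 => [|c /eqP]; last by rewrite b0.
    by rewrite b0; case: eqP => //= e; lia.
  have b_lt : (b.-1 < ns j)%N by have := ltn_ord b; lia.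
  rewrite (big_pred1 (Ordinal b_lt)) /=; last by move=> c; rewrite /= -val_eqE /=; lia.
  by congr (_%:R); lia.
rewrite big1 => [|c /eqP c_eq]; last by have := ltn_ord c; lia.
rewrite big1 // => c /eqP b_eq /=; case: eqP => //= e.
by have := ltn_ord b; have := ltn_ord a; lia.
Qed.

(** The shift kills the kernel of the nilpotent matrix, as the first vector of
    a block is sent below the first vector of the strictly smaller next one. *)
Lemma jordan_shift_factor : jordan_shift 0 = jordan_shift 1 *m J.
Proof.
rewrite /J /jordan_shift mul_mxblock_mxdiag.
apply/eq_mxblock => i j; apply/matrixP => a b.
rewrite mul_jordan_blockE mxE; under [RHS]eq_bigr do rewrite mxE.
have [ij|nij] := boolP (i == j.+1 :> nat); last by rewrite !big1.
have ns_lt : (ns i < ns j)%N by apply: ns_decr; rewrite (eqP ij).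
have [b0|b_gt0] := posnP b.
  rewrite big1 => [|c /eqP]; last by rewrite b0.
  by rewrite b0; case: eqP => //= e; have := ltn_ord a; lia.
have b_lt : (b.-1 < ns j)%N by have := ltn_ord b; lia.
rewrite (big_pred1 (Ordinal b_lt)) /=; last by move=> c; rewrite /= -val_eqE /=; lia.
by congr (_%:R); lia.
Qed.

Lemma mxblock_Rank (B : forall i j, 'M[K]_(ns i, ns j)) i j a b :
  (\mxblock_(i, j) B i j) (tagnat.Rank i a) (tagnat.Rank j b) = B i j a b.
Proof. by have := congr1 (fun M : matrix _ _ _ => M a b) (mxblockK B i j); rewrite mxE. Qed.

Definition jvec (i : 'I_s) (a : 'I_(ns i)) : 'cV[K]_(\sum_i ns i) :=
  delta_mx (tagnat.Rank i a) 0.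

Lemma jvecE i a k c :
  @jvec i a (tagnat.Rank k c) 0 = ((k == i) && (c == a :> nat))%:R.
Proof. by rewrite mxE eqxx andbT -val_eqE tagnat.eq_Rank. Qed.

Lemma jvec_ext (u v : 'cV[K]_(\sum_i ns i)) :
  (forall i a, u (tagnat.Rank i a) 0 = v (tagnat.Rank i a) 0) -> u = v.
Proof.
by move=> uv; apply/matrixP => p j; rewrite ord1 -(tagnat.sig2K p) uv.
Qed.

Lemma jordan_jvecE i a k c :
  (J *m @jvec i a) (tagnat.Rank k c) 0 = ((k == i) && (a == c.+1 :> nat))%:R.
Proof.
rewrite /jvec -colE mxE /J /mxdiag mxblock_Rank.
by case: eqVneq a => [<-|_] a; rewrite ?conform_mx_id mxE.
Qed.

Lemma jordan_jvecS i (a b : 'I_(ns i)) : b = a.+1 :> nat -> J *m jvec b = jvec a.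
Proof.
move=> ba; apply: jvec_ext => k c.
by rewrite jordan_jvecE jvecE ba eqSS [c == a :> nat]eq_sym.
Qed.

Lemma jordan_jvec0 i (a : 'I_(ns i)) : a = 0%N :> nat -> J *m jvec a = 0.
Proof.
by move=> a0; apply: jvec_ext => k c; rewrite jordan_jvecE a0 andbF mxE.
Qed.

Lemma shift_jvec_last i k (a : 'I_(ns i)) (c : 'I_(ns k)) :
  k = i.+1 :> nat -> a.+1 = ns i -> c.+1 = ns k ->
  jordan_shift 0 *m jvec a = jvec c.
Proof.
move=> ki a_last c_last; apply: jvec_ext => l d.
rewrite {1}/jvec -colE mxE mxblock_Rank jvecE mxE.
have [lk|nlk] := eqVneq l k; last first.
  by rewrite -ki val_eqE (negbTE nlk).
by congr (_%:R); move: d; rewrite lk -ki eqxx => d /=; lia.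
Qed.

End JordanShift.

(** Nakayama's lemma for a pair of commuting operators, phrased through an
    operator Th that anticommutes with both: the first generator v and the
    shift X generate V modulo A V, and S agrees with X modulo A V, so the
    kernel of Th, which is stable under A and S, is everything as soon as it
    contains v. *)
Lemma jordan_shift_cyclic (K : numFieldType) (m : nat) (A : 'M[K]_m)
    (s : nat) (ns : 'I_s -> nat) :
    (forall i j : 'I_s, (i < j)%N -> (ns j < ns i)%N) ->
    (forall i, (0 < ns i)%N) -> nilpotent_jordan_type A ns ->
  exists X Y : 'M[K]_m, exists v : 'cV[K]_m,
    [/\ X *m A = A *m X, X = Y *m A &
     forall S Z Th : 'M[K]_m, S = X + A *m Z -> S *m A = A *m S ->
       Th *m A = - (A *m Th) -> Th *m S = - (S *m Th) -> Th *m v = 0 -> Th = 0].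
Proof.
move=> ns_decr ns_gt0 [P [Q [PQ QP AE]]].
set J := (\mxdiag_i _) in AE.
pose X0 := jordan_shift K ns 0; pose X := P *m X0 *m Q.
have AP : A *m P = P *m J by rewrite AE -!mulmxA QP mulmx1.
have XP : X *m P = P *m X0 by rewrite /X -!mulmxA QP mulmx1.
have last_lt i : ((ns i).-1 < ns i)%N by have := ns_gt0 i; lia.
pose v : 'cV[K]_m := if insub 0%N is Some i0 then
  P *m jvec K (Ordinal (last_lt i0)) else 0.
exists X, (P *m jordan_shift K ns 1 *m Q), v; split.
- rewrite {1}AE mulmxA (mulmxA X) XP -(mulmxA P) -jordan_shift_comm //.
  by rewrite mulmxA -AP /X -!mulmxA.
- rewrite /X /X0 (jordan_shift_factor K ns_decr) AE -!mulmxA.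
  by rewrite (mulmxA Q P) QP mul1mx.
move=> S Z Th SE SA ThA ThS Thv.
(* Th maps every generator into A Th V: pass from a block to the next with
   X = S - A Z. *)
have last_im k (i : 'I_s) : i = k :> nat -> exists y : 'cV[K]_m,
    Th *m (P *m jvec K (Ordinal (last_lt i))) = A *m (Th *m y).
  elim: k i => [|k IHk] i ik.
    exists 0; rewrite !mulmx0 -Thv /v; case: insubP => [j _ j0|]; last first.
      by move=> /negP[]; have := ltn_ord i; rewrite ik.
    by have -> : i = j by apply: val_inj; rewrite /= ik j0.
  have k_lt : (k < s)%N by rewrite -ltnS -ik ltnW // ltnS.
  have [y yE] := IHk (Ordinal k_lt) erefl.
  set w := P *m _ in yE; exists (S *m y + Z *m w).
  have -> : P *m jvec K (Ordinal (last_lt i)) = S *m w - A *m Z *m w.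
    rewrite SE mulmxDl addrK /w mulmxA XP -mulmxA.
    by rewrite (shift_jvec_last K (k := i) (c := Ordinal (last_lt i))) //= prednK.
  have ThAu (u : 'cV[K]_m) : Th *m (A *m u) = - (A *m (Th *m u)).
    by rewrite mulmxA ThA mulNmx mulmxA.
  have ThSu (u : 'cV[K]_m) : Th *m (S *m u) = - (S *m (Th *m u)).
    by rewrite mulmxA ThS mulNmx mulmxA.
  rewrite mulmxBr -mulmxA ThAu opprK ThSu yE (mulmxA S) SA -mulmxA.
  by rewrite -mulmxN -ThSu -mulmxDr -mulmxDr.
have jvec_im i a : exists y : 'cV[K]_m, Th *m (P *m @jvec K _ _ i a) = A *m (Th *m y).
  have [a_lt|a_ge] := ltnP a.+1 (ns i); last first.
    suff -> : a = Ordinal (last_lt i) by apply: last_im.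
    by apply: val_inj => /=; have := ltn_ord a; lia.
  exists (- (P *m jvec K (Ordinal a_lt))).
  rewrite -(jordan_jvecS K (b := Ordinal a_lt)) // -/J (mulmxA P) -AP.
  by rewrite -mulmxA (mulmxA Th) ThA mulNmx mulmxN mulmxN -mulmxA.
(* Th V is contained in A Th V, hence in every A^k Th V. *)
have [M ThE] : exists M, Th = A *m Th *m M.
  have /fin_all_exists[y yE] (q : 'I_(\sum_i ns i)) :
      exists y : 'cV[K]_m, Th *m (P *m delta_mx q 0) = A *m (Th *m y).
    by rewrite -(tagnat.sig2K q); exact: jvec_im.
  exists ((\matrix_(i, q) y q i 0) *m Q); rewrite mulmxA.
  rewrite -[LHS]mulmx1 -PQ mulmxA; congr (_ *m Q).
  apply/matrixP => i q; have := congr1 (fun u : matrix _ _ _ => u i 0) (yE q).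
  rewrite mulmxA -colE mxE => ->; rewrite mulmxA !mxE; apply: eq_bigr => k _.
  by congr (_ * _); rewrite mxE.
have iterE k : exists N, Th = A ^+ k *m Th *m N.
  elim: k => [|k [N ThN]]; first by exists 1%:M; rewrite expr0 mul1mx mulmx1.
  exists (M *m N); rewrite {1}ThN {1}ThE -!mulmxA.
  by rewrite (mulmxA (A ^+ k)) exprSr.
have A_jvec n i (a : 'I_(ns i)) : (a < n)%N -> A ^+ n *m (P *m jvec K a) = 0.
  elim: n i a => // n IHn i a a_le; rewrite exprSr -mulmxA (mulmxA A) AP -mulmxA.
  rewrite -/J.
  have [a0|a_gt0] := posnP a; first by rewrite jordan_jvec0 // !mulmx0.
  have a_lt : (a.-1 < ns i)%N by have := ltn_ord a; lia.
  rewrite (jordan_jvecS K (a := Ordinal a_lt)) ?IHn //=; lia.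
have A_nil : A ^+ (\sum_i ns i) = 0.
  suff AP0 : A ^+ (\sum_i ns i) *m P = 0 by rewrite -[LHS]mulmx1 -PQ mulmxA AP0 mul0mx.
  apply/matrixP => i q; rewrite [RHS]mxE.
  have := A_jvec (\sum_i ns i) _ (tagnat.sig2 q); rewrite /jvec tagnat.sig2K.
  rewrite mulmxA -colE => /(_ _)/(congr1 (fun u : matrix _ _ _ => u i 0)).
  rewrite !mxE; apply; apply: leq_trans (ltn_ord _) _.
  by rewrite (bigD1 (tagnat.sig1 q)) //= leq_addr.
by have [N ->] := iterE (\sum_i ns i); rewrite A_nil !mul0mx.
Qed.

(** * Self-adjoint and skew-adjoint operators *)

Section AdjointSpaces.
Variables (K : numFieldType) (m : nat).
Implicit Types A S X Y T Q : 'M[K]_m.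

Definition anticomm A X := X *m A + A *m X.

Fact anticomm_is_linear A : linear (anticomm A).
Proof.
move=> c X Y; rewrite /anticomm mulmxDl mulmxDr -scalemxAl -scalemxAr scalerDr.
by rewrite addrACA.
Qed.
HB.instance Definition _ A := GRing.isLinear.Build K 'M[K]_m 'M[K]_m _ (anticomm A)
  (anticomm_is_linear A).

Definition anticommv A : {vspace 'M[K]_m} := lker (linfun (anticomm A)).

Lemma anticommvP A X : reflect (X *m A = - (A *m X)) (X \in anticommv A).
Proof.
by rewrite memv_ker lfunE /= addr_eq0; apply: eqP.
Qed.

Lemma anticomm_anticommv A S Q :
  S *m A = A *m S -> Q \in anticommv A -> anticomm S Q \in anticommv A.
Proof.
move=> SA /anticommvP QA; apply/anticommvP.
have QSA : Q *m S *m A = - (A *m (Q *m S)) by rewrite -mulmxA SA mulmxA QA mulNmx !mulmxA.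
have SQA : S *m Q *m A = - (A *m (S *m Q)) by rewrite -mulmxA QA mulmxN !mulmxA SA.
by rewrite /anticomm mulmxDl mulmxDr opprD QSA SQA.
Qed.

Lemma mxtrace_anticomm A X Y : \tr (anticomm A X *m Y) = \tr (X *m anticomm A Y).
Proof.
rewrite /anticomm mulmxDl mulmxDr !raddfD /= addrC !mulmxA; congr (_ + _).
by rewrite -mulmxA mxtrace_mulC.
Qed.

Lemma mxtrace_eq0 Y : (forall X, \tr (X *m Y) = 0) -> Y = 0.
Proof.
move=> trY; apply/matrixP => i j; rewrite mxE -(trY (delta_mx j i)) mxtrace_mulC.
rewrite /mxtrace (bigD1 i) //= big1 => [|k ki]; last first.
  by rewrite mxE big1 // => l _; rewrite mxE (negbTE ki) andbF mulr0.
rewrite addr0 mxE (bigD1 j) //= big1 => [|l lj].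
  by rewrite mxE !eqxx mulr1 addr0.
by rewrite mxE (negbTE lj) mulr0.
Qed.

(** Being orthogonal to U for the trace form is a system of dim U linear
    equations. *)
Lemma dim_le_annihilator (U V W : {vspace 'M[K]_m}) :
    (forall Y, Y \in W -> (forall X, X \in U -> \tr (X *m Y) = 0) -> Y \in V) ->
  (\dim W <= \dim U + \dim V)%N.
Proof.
move=> annV; pose f Y : 'rV[K]_(\dim U) := \row_i \tr ((vbasis U)`_i *m Y).
have f_lin : linear f.
  move=> c X Y; apply/rowP => i; rewrite !mxE mulmxDr -scalemxAr.
  by rewrite raddfD /= mxtraceZ.
pose fM := GRing.isLinear.Build K 'M[K]_m _ _ f f_lin.
pose F : {linear 'M[K]_m -> 'rV[K]_(\dim U)} := HB.pack f fM.
rewrite -(limg_ker_dim (linfun F)) addnC leq_add //.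
  by rewrite (leq_trans (dimvS (subvf _))) // dimvf dim_matrix mul1r.
apply: dimvS; apply/subvP => Y; rewrite memv_cap memv_ker lfunE /=.
move=> /andP[YW /eqP fY]; apply: annV => // X XU.
rewrite (coord_vbasis XU) mulmx_suml raddf_sum big1 //= => i _.
have := congr1 (fun u : matrix _ _ _ => u 0 i) fY; rewrite !mxE => trY0.
by rewrite -scalemxAl mxtraceZ trY0 mulr0.
Qed.

Variable Om : 'M[K]_m.
Hypothesis OmS : symplectic_form Om.

Fact sadj_is_linear : linear (sadj Om).
Proof.
move=> c X Y; rewrite /sadj linearD linearZ /= mulmxDr mulmxDl.
by rewrite -scalemxAr -scalemxAl.
Qed.
HB.instance Definition _ := GRing.isLinear.Build K 'M[K]_m 'M[K]_m _ (sadj Om)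
  sadj_is_linear.

Lemma sadjM X Y : sadj Om (X *m Y) = sadj Om Y *m sadj Om X.
Proof.
by have [_ Omu] := OmS; rewrite /sadj trmx_mul !mulmxA mulmxK.
Qed.

Lemma sadj1 : sadj Om 1%:M = 1%:M.
Proof. by have [_ Omu] := OmS; rewrite /sadj trmx1 mulmx1 mulVmx. Qed.

Lemma sadj_invmx X : X \in unitmx -> sadj Om (invmx X) = invmx (sadj Om X).
Proof.
move=> Xu; have XX : sadj Om X *m sadj Om (invmx X) = 1%:M.
  by rewrite -sadjM // mulVmx // sadj1.
by have [Xu' _] := mulmx1_unit XX; rewrite -[LHS](mulKmx Xu') XX mulmx1.
Qed.

Lemma mxtrace_sadj X : \tr (sadj Om X) = \tr X.
Proof.
by have [_ Omu] := OmS; rewrite /sadj mxtrace_mulC mulmxA mulmxV // mul1mx mxtrace_tr.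
Qed.

Fact sadj_signed_linear (b : bool) :
  linear (fun X => sadj Om X - (-1) ^+ b *: X).
Proof.
by move=> c X Y; rewrite linearP !scalerDr scalerN opprD addrACA !scalerA [c * _]mulrC.
Qed.
(** Its kernel is the space of self-adjoint matrices when b = false, and of
    skew-adjoint ones, that is sp(V), when b = true; the sign lets both cases
    share their proofs. *)
Definition sadj_signed (b : bool) X := sadj Om X - (-1) ^+ b *: X.
HB.instance Definition _ (b : bool) := GRing.isLinear.Build K 'M[K]_m 'M[K]_m _ (sadj_signed b)
  (sadj_signed_linear b).

Definition sadjv (b : bool) : {vspace 'M[K]_m} := lker (linfun (sadj_signed b)).

Lemma sadjvP (b : bool) X : reflect (sadj Om X = (-1) ^+ b *: X) (X \in sadjv b).
Proof. by rewrite memv_ker lfunE /= subr_eq0; apply: eqP. Qed.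

Lemma sadjv_spP X : reflect (sadj Om X = - X) (X \in sadjv true).
Proof. by apply: (iffP (sadjvP _ _)); rewrite expr1 scaleN1r. Qed.

Lemma sadjv_saP X : reflect (sadj Om X = X) (X \in sadjv false).
Proof. by apply: (iffP (sadjvP _ _)); rewrite expr0 scale1r. Qed.

Lemma anticomm_sadjv A (b : bool) X : sadj Om A = - A -> X \in sadjv b ->
  anticomm A X \in sadjv (~~ b).
Proof.
move=> A_sp /sadjvP Xb; apply/sadjvP; rewrite /anticomm linearD /= !sadjM Xb A_sp.
rewrite -scalemxAr -scalemxAl mulmxN mulNmx addrC scalerDr signrN.
by rewrite !scalerN !scaleNr.
Qed.

(** The trace is invariant under the adjoint, which changes the sign of the
    trace of such a product. *)
Lemma mxtrace_sadjv0 b X Y :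
  X \in sadjv b -> Y \in sadjv (~~ b) -> \tr (X *m Y) = 0.
Proof.
move=> /sadjvP Xb /sadjvP Yb; have := mxtrace_sadj (X *m Y).
rewrite sadjM Xb Yb -scalemxAl -scalemxAr scalerA !mxtraceZ mxtrace_mulC signrN.
rewrite mulNr -expr2 sqrr_sign mulN1r => /eqP.
by rewrite eq_sym -subr_eq0 opprK -mulr2n mulrn_eq0 => /eqP.
Qed.

(** The trace form is nondegenerate on all matrices, which are the orthogonal
    sum of the two eigenspaces of the adjoint. *)
Lemma sadjv_nondegenerate b Y : Y \in sadjv b ->
  (forall X, X \in sadjv b -> \tr (X *m Y) = 0) -> Y = 0.
Proof.
move=> Yb trY; apply: mxtrace_eq0 => X.
have two_neq0 : 2 != 0 :> K by rewrite pnatr_eq0.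
have proj (c : bool) : X + (-1) ^+ c *: sadj Om X \in sadjv c.
  apply/sadjvP; rewrite linearD linearZ /= sadjK // scalerDr scalerA -expr2.
  by rewrite sqrr_sign scale1r addrC.
have XE : 2 *: X = (X + (-1) ^+ b *: sadj Om X) + (X + (-1) ^+ (~~ b) *: sadj Om X).
  by rewrite signrN scaleNr addrACA subrr addr0 scaler_nat mulr2n.
apply: (mulfI two_neq0); rewrite mulr0 -mxtraceZ scalemxAl XE mulmxDl raddfD /=.
by rewrite trY // (mxtrace_sadjv0 (b := ~~ b)) ?negbK ?addr0.
Qed.

(** The operator X |-> X A + A X exchanges the two eigenspaces of the adjoint
    and is symmetric for the trace form; so the elements of one of them that
    are orthogonal to the image of the other are killed by it. The rank on one
    side thus bounds the rank on the other. *)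
Lemma dim_sadjv_anticomm A b : sadj Om A = - A ->
  (\dim (sadjv b) + \dim (sadjv (~~ b) :&: anticommv A)
     <= \dim (sadjv (~~ b)) + \dim (sadjv b :&: anticommv A))%N.
Proof.
move=> A_sp; pose f := linfun (anticomm A).
rewrite -(limg_ker_dim f (sadjv (~~ b))) addnC -addnA leq_add2l.
apply: dim_le_annihilator => Y Yb trY; rewrite memv_cap Yb memv_ker lfunE /=.
apply/eqP/(@sadjv_nondegenerate (~~ b)); first exact: anticomm_sadjv.
move=> X Xb; rewrite -mxtrace_anticomm trY //.
by have := memv_img f Xb; rewrite lfunE.
Qed.

(** Multiplication by Om turns the skew-adjoint matrices into the symmetric
    ones and the self-adjoint matrices into the antisymmetric ones. A symmetric
    matrix is made of an arbitrary diagonal and of the strictly lower part of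
    an antisymmetric matrix. *)
Lemma dim_sadjv : (\dim (sadjv false) + m <= \dim (sadjv true))%N.
Proof.
have [skO Omu] := OmS.
have sadjvE (b : bool) X : (X \in sadjv b) = ((Om *m X)^T == - (-1) ^+ b *: (Om *m X)).
  apply/sadjvP/eqP => [Xb|Xb].
    by rewrite scaleNr scalemxAr -Xb /sadj !mulmxA mulmxV // mul1mx trmx_mul skO mulmxN.
  apply: (can_inj (mulKmx Omu)); rewrite /sadj !mulmxA mulmxV // mul1mx -scalemxAr.
  by apply: oppr_inj; rewrite -mulmxN -skO -trmx_mul Xb scaleNr.
pose dg X : 'rV[K]_m := \row_i (Om *m X) i i.
have dg_lin : linear dg.
  by move=> c X Y; apply/rowP => i; rewrite mxE mulmxDr -scalemxAr !mxE.
pose dgM := GRing.isLinear.Build K 'M[K]_m _ _ dg dg_lin.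
pose Dg : {linear 'M[K]_m -> 'rV[K]_m} := HB.pack dg dgM.
pose lo (N : 'M[K]_m) : 'M[K]_m := \matrix_(i, j) if (i < j)%N then N j i else N i j.
have loE N i j : lo N i j = if (i < j)%N then N j i else N i j by rewrite mxE.
pose sy X := invmx Om *m lo (Om *m X).
have sy_lin : linear sy.
  move=> c X Y; rewrite /sy scalemxAr -mulmxDr; congr (_ *m _).
  apply/matrixP => i j; rewrite mulmxDr -scalemxAr.
  by rewrite !mxE; case: ifP.
pose syM := GRing.isLinear.Build K 'M[K]_m _ _ sy sy_lin.
pose Sy : {linear 'M[K]_m -> 'M[K]_m} := HB.pack sy syM.
have Om_sy X : Om *m sy X = lo (Om *m X) by rewrite /sy mulmxA mulmxV ?mul1mx.
have skew X i j : X \in sadjv false -> (Om *m X) j i = - (Om *m X) i j.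
  rewrite sadjvE expr0 scaleN1r => /eqP/matrixP/(_ i j).
  by rewrite [LHS]mxE [RHS]mxE.
have skew_diag X i : X \in sadjv false -> (Om *m X) i i = 0.
  move=> /(skew _ i i)/eqP; rewrite -addr_eq0 -mulr2n mulrn_eq0 => /eqP //.
rewrite -(limg_ker_dim (linfun Dg) (sadjv true)) leq_add //.
  rewrite -(limg_dim_eq (f := linfun Sy) (U := sadjv false)); last first.
    apply/eqP; rewrite -subv0; apply/subvP => X; rewrite memv_cap memv_ker lfunE /=.
    move=> /andP[X_sk /eqP sy0]; rewrite memv0; apply/eqP.
    have lo0 : lo (Om *m X) = 0 by rewrite -Om_sy sy0 mulmx0.
    apply: (can_inj (mulKmx Omu)); rewrite mulmx0; apply/matrixP => i j; rewrite [RHS]mxE.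
    have lo0E k l : lo (Om *m X) k l = 0 by rewrite lo0 mxE.
    have := lo0E i j; have := lo0E j i; rewrite !loE.
    by case: ltngtP => ij lji lij //; rewrite skew // lij oppr0.
  apply: dimvS; apply/subvP => _ /memv_imgP[X X_sk ->].
  rewrite memv_cap memv_ker !lfunE /= sadjvE Om_sy; apply/andP; split.
    rewrite expr1 scaleNr scaleN1r opprK; apply/eqP/matrixP => i j.
    by rewrite [LHS]mxE !loE; case: ltngtP => // /val_inj ->.
  by apply/eqP/rowP => i; rewrite mxE Om_sy loE ltnn skew_diag // mxE.
suff -> : (linfun Dg @: sadjv true)%VS = fullv by rewrite dimvf dim_matrix mul1r.
apply/eqP; rewrite eqEsubv subvf; apply/subvP => d _; apply/memv_imgP.
exists (invmx Om *m diag_mx d).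
  rewrite sadjvE !mulmxA mulmxV // mul1mx expr1 scaleNr scaleN1r opprK.
  by rewrite tr_diag_mx.
by rewrite lfunE; apply/rowP => i; rewrite [RHS]mxE mulmxA mulmxV // mul1mx mxE eqxx.
Qed.

(** The hypothesis on v bounds the dimension of the kernel by m, since Q |-> Q v
    is injective on it, and the dimension of the source exceeds that of the
    target by at least m. *)
Lemma anticomm_onto A S (v : 'cV[K]_m) : sadj Om A = - A -> sadj Om S = - S ->
    S *m A = A *m S ->
    (forall Q, Q *m A = - (A *m Q) -> Q *m S = - (S *m Q) -> Q *m v = 0 -> Q = 0) ->
  (linfun (anticomm S) @: (sadjv true :&: anticommv A) = sadjv false :&: anticommv A)%VS.
Proof.
move=> A_sp S_sp SA v_cyc; set U := (sadjv true :&: anticommv A)%VS.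
set f := linfun (anticomm S).
apply/eqP; rewrite eqEdim; apply/andP; split.
  apply/subvP => _ /memv_imgP[Q QU ->].
  move: QU; rewrite memv_cap lfunE /= memv_cap => /andP[Q_sp QA].
  by rewrite (anticomm_sadjv S_sp Q_sp) anticomm_anticommv.
pose ev (X : 'M[K]_m) : 'cV[K]_m := X *m v.
have ev_lin : linear ev by move=> c X Y; rewrite /ev mulmxDl scalemxAl.
pose evM := GRing.isLinear.Build K 'M[K]_m _ _ ev ev_lin.
pose Ev : {linear 'M[K]_m -> 'cV[K]_m} := HB.pack ev evM.
have kerU : (\dim (U :&: lker f) <= m)%N.
  rewrite -(limg_dim_eq (f := linfun Ev) (U := (U :&: lker f)%VS)); last first.
    apply/eqP; rewrite -subv0; apply/subvP => X.
    rewrite memv_cap => /andP[]; rewrite memv_cap => /andP[XU /anticommvP XS].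
    move: XU; rewrite memv_cap memv_ker lfunE memv0 => /andP[_ /anticommvP XA] /eqP Xv.
    by apply/eqP/v_cyc.
  by rewrite (leq_trans (dimvS (subvf _))) // dimvf dim_matrix mulr1.
have := dim_sadjv_anticomm true A_sp; have := dim_sadjv; rewrite -/U /=.
have := limg_ker_dim f U; move: kerU; do 6!move: (\dim _) => ?; lia.
Qed.

End AdjointSpaces.

(** S is X - adj X for the shift X. Since X factors through A on the right,
    adj X factors through A on the left, so that S and X agree modulo the image
    of A. *)
Lemma regular_centralizing_element (K : numFieldType) (m : nat) (Om A : 'M[K]_m)
    (s : nat) (ns : 'I_s -> nat) :
    symplectic_form Om -> sadj Om A = - A ->
    (forall i j : 'I_s, (i < j)%N -> (ns j < ns i)%N) ->
    (forall i, (0 < ns i)%N) -> nilpotent_jordan_type A ns ->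
  exists S, [/\ sadj Om S = - S, S *m A = A *m S &
    (linfun (anticomm S) @: (sadjv Om true :&: anticommv A) = sadjv Om false :&: anticommv A)%VS].
Proof.
move=> OmS A_sp ns_decr ns_gt0 A_jordan.
have [X [Y [v [XA XE v_cyc]]]] := jordan_shift_cyclic ns_decr ns_gt0 A_jordan.
have X'A : sadj Om X *m A = A *m sadj Om X.
  apply: oppr_inj; rewrite -mulmxN -mulNmx -A_sp -!sadjM //.
  by rewrite XA.
have X'E : sadj Om X = - (A *m sadj Om Y) by rewrite XE sadjM // A_sp mulNmx.
pose S := X - sadj Om X.
have S_sp : sadj Om S = - S by rewrite /S linearB /= sadjK // opprB.
have SA : S *m A = A *m S by rewrite /S mulmxBl mulmxBr XA X'A.
have SE : S = X + A *m sadj Om Y by rewrite /S X'E opprK.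
exists S; split=> //; apply: (anticomm_onto OmS (v := v)) => // Q QA QS Qv.
exact: v_cyc SE SA QA QS Qv.
Qed.

(** * The entrywise norm on complex matrices *)

Section MatrixNorm.
Variable R : realType.
Local Notation C := (Cplx R).

(** A real-valued modulus, since the norm of the field of complex numbers takes
    complex values. *)
Definition cnorm (z : C) : R := complex.Re `|z|.

Lemma cnormE (z : C) : `|z| = (cnorm z)%:C%C :> C.
Proof. by rewrite /cnorm /Num.norm /=. Qed.

Lemma cnorm_ge0 z : 0 <= cnorm z.
Proof. by rewrite -lecR -cnormE; exact: normr_ge0. Qed.

Lemma cnormD x y : cnorm (x + y) <= cnorm x + cnorm y.
Proof. by rewrite -lecR rmorphD /= -!cnormE; exact: ler_normD. Qed.

Lemma cnormM x y : cnorm (x * y) = cnorm x * cnorm y.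
Proof. by apply: complexI; rewrite rmorphM /= -!cnormE; exact: normrM. Qed.

Lemma cnormN x : cnorm (- x) = cnorm x.
Proof. by rewrite /cnorm normrN. Qed.

Lemma cnorm0 : cnorm 0 = 0.
Proof. by rewrite /cnorm normr0. Qed.

Lemma cnorm_eq0 z : cnorm z = 0 -> z = 0.
Proof. by move=> z0; apply/eqP; rewrite -normr_eq0 cnormE z0. Qed.

Lemma cnorm_real (x : R) : cnorm (x%:C%C : C) = `|x|.
Proof. by rewrite /cnorm {1}/Num.norm /= expr0n /= addr0 sqrtr_sqr. Qed.

Lemma cnorm_half : cnorm (2^-1 : C) = 2^-1.
Proof.
have -> : 2^-1 = (2^-1)%:C%C :> C by rewrite fmorphV rmorph_nat.
by rewrite cnorm_real ger0_norm ?invr_ge0.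
Qed.

Lemma cnorm_sqrt a b : cnorm (a +i* b)%C = Num.sqrt (a ^+ 2 + b ^+ 2).
Proof. by rewrite /cnorm /Num.norm. Qed.

Lemma Re_le_cnorm (z : C) : `|complex.Re z| <= cnorm z.
Proof.
case: z => a b; rewrite cnorm_sqrt -sqrtr_sqr ler_sqrt ?addr_ge0 ?sqr_ge0 //.
by rewrite lerDl sqr_ge0.
Qed.

Lemma Im_le_cnorm (z : C) : `|complex.Im z| <= cnorm z.
Proof.
case: z => a b; rewrite cnorm_sqrt -sqrtr_sqr ler_sqrt ?addr_ge0 ?sqr_ge0 //.
by rewrite lerDr sqr_ge0.
Qed.

Lemma cnorm_le_ReIm (z : C) : cnorm z <= `|complex.Re z| + `|complex.Im z|.
Proof.
case: z => a b; rewrite cnorm_sqrt -[leRHS]ger0_norm ?addr_ge0 //.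
rewrite -[leRHS]sqrtr_sqr ler_sqrt ?sqr_ge0 // sqrrD !real_normK ?num_real //.
by rewrite addrAC lerDl mulrn_wge0 // mulr_ge0.
Qed.

Definition l1norm m n (X : 'M[C]_(m, n)) : R := \sum_i \sum_j cnorm (X i j).

Lemma l1norm_ge0 m n (X : 'M[C]_(m, n)) : 0 <= l1norm X.
Proof. by apply: sumr_ge0 => i _; apply: sumr_ge0 => j _; exact: cnorm_ge0. Qed.

Lemma l1normD m n (X Y : 'M[C]_(m, n)) : l1norm (X + Y) <= l1norm X + l1norm Y.
Proof.
rewrite -big_split /=; apply: ler_sum => i _; rewrite -big_split /=.
by apply: ler_sum => j _; rewrite mxE cnormD.
Qed.

Lemma l1normN m n (X : 'M[C]_(m, n)) : l1norm (- X) = l1norm X.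
Proof. by apply: eq_bigr => i _; apply: eq_bigr => j _; rewrite mxE cnormN. Qed.

Lemma l1normB m n (X Y : 'M[C]_(m, n)) : l1norm (X - Y) <= l1norm X + l1norm Y.
Proof. by rewrite -(l1normN Y) l1normD. Qed.

Lemma l1normBC m n (X Y : 'M[C]_(m, n)) : l1norm (X - Y) = l1norm (Y - X).
Proof. by rewrite -l1normN opprB. Qed.

Lemma l1normZ m n c (X : 'M[C]_(m, n)) : l1norm (c *: X) = cnorm c * l1norm X.
Proof.
rewrite /l1norm mulr_sumr; apply: eq_bigr => i _; rewrite mulr_sumr.
by apply: eq_bigr => j _; rewrite mxE cnormM.
Qed.

Lemma l1norm0 m n : l1norm (0 : 'M[C]_(m, n)) = 0.
Proof. by rewrite /l1norm big1 // => i _; rewrite big1 // => j _; rewrite mxE cnorm0. Qed.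

Lemma cnorm_le_l1norm m n (X : 'M[C]_(m, n)) i j : cnorm (X i j) <= l1norm X.
Proof.
rewrite /l1norm (bigD1 i) //= (bigD1 j) //= -addrA lerDl addr_ge0 //.
  by apply: sumr_ge0 => *; exact: cnorm_ge0.
by apply: sumr_ge0 => *; apply: sumr_ge0 => *; exact: cnorm_ge0.
Qed.

Lemma l1norm_eq0 m n (X : 'M[C]_(m, n)) : l1norm X <= 0 -> X = 0.
Proof.
move=> X0; apply/matrixP => i j; rewrite mxE; apply: cnorm_eq0; apply: le_anti.
by rewrite cnorm_ge0 (le_trans (cnorm_le_l1norm X i j)).
Qed.

Lemma cnorm_sum (I : finType) (F : I -> C) :
  cnorm (\sum_i F i) <= \sum_i cnorm (F i).
Proof.
elim/big_rec2: _ => [|i y z _ yz]; first by rewrite cnorm0.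
by rewrite (le_trans (cnormD _ _)) // lerD2l.
Qed.

Lemma l1norm_sum (I : finType) m n (F : I -> 'M[C]_(m, n)) :
  l1norm (\sum_i F i) <= \sum_i l1norm (F i).
Proof.
elim/big_rec2: _ => [|i y z _ yz]; first by rewrite l1norm0.
by rewrite (le_trans (l1normD _ _)) // lerD2l.
Qed.

Lemma l1normM m n p (X : 'M[C]_(m, n)) (Y : 'M[C]_(n, p)) :
  l1norm (X *m Y) <= l1norm X * l1norm Y.
Proof.
rewrite /l1norm mulr_suml; apply: ler_sum => i _; rewrite mulr_suml.
apply: (@le_trans _ _ (\sum_k \sum_j cnorm (X i j) * cnorm (Y j k))).
  apply: ler_sum => k _; rewrite mxE (le_trans (cnorm_sum _)) //.
  by apply: ler_sum => j _; rewrite cnormM.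
rewrite exchange_big /=; apply: ler_sum => j _; rewrite -mulr_sumr.
apply: ler_wpM2l; first exact: cnorm_ge0.
rewrite (bigD1 j) //= lerDl; apply: sumr_ge0 => *; apply: sumr_ge0 => *.
exact: cnorm_ge0.
Qed.

Lemma l1normM3 m n p q (X : 'M[C]_(m, n)) (Y : 'M[C]_(n, p)) (Z : 'M[C]_(p, q)) :
  l1norm (X *m Y *m Z) <= l1norm X * l1norm Y * l1norm Z.
Proof. by rewrite (le_trans (l1normM _ _)) // ler_wpM2r ?l1norm_ge0 ?l1normM. Qed.

Lemma l1norm_block_diag n (X Y : 'M[C]_n) :
  l1norm (block_mx X 0 0 Y) = l1norm X + l1norm Y.
Proof.
rewrite /l1norm big_split_ord; congr (_ + _); apply: eq_bigr => i _; rewrite big_split_ord /=.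
  rewrite [X in _ + X]big1 ?addr0 => [|j _]; last by rewrite block_mxEur mxE cnorm0.
  by apply: eq_bigr => j _; rewrite block_mxEul.
rewrite [X in X + _]big1 ?add0r => [|j _]; last by rewrite block_mxEdl mxE cnorm0.
by apply: eq_bigr => j _; rewrite block_mxEdr.
Qed.

Lemma l1norm_ursubmx n (M : 'M[C]_(n + n)) :
  l1norm (ursubmx M) <= l1norm M.
Proof.
rewrite /l1norm big_split_ord /= -[leLHS]addr0 lerD //; last first.
  by apply: sumr_ge0 => i _; apply: sumr_ge0 => j _; exact: cnorm_ge0.
apply: ler_sum => i _; rewrite big_split_ord /= -[leLHS]add0r lerD //.
  by apply: sumr_ge0 => j _; exact: cnorm_ge0.
by apply: ler_sum => j _; rewrite !mxE.
Qed.

Lemma l1norm_linear_bounded m n p q (F : {linear 'M[C]_(m, n) -> 'M[C]_(p, q)}) :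
  exists2 c : R, 1 <= c & forall X, l1norm (F X) <= c * l1norm X.
Proof.
exists (1 + \sum_i \sum_j l1norm (F (delta_mx i j))) => [|X].
  by rewrite lerDl; apply: sumr_ge0 => i _; apply: sumr_ge0 => j _; exact: l1norm_ge0.
rewrite {1}(matrix_sum_delta X) linear_sum (le_trans (l1norm_sum _)) //.
rewrite mulrDl mul1r -[leLHS]add0r lerD ?l1norm_ge0 // mulr_suml ler_sum // => i _.
rewrite linear_sum (le_trans (l1norm_sum _)) // mulr_suml ler_sum // => j _.
by rewrite linearZ l1normZ mulrC ler_wpM2l ?l1norm_ge0 ?cnorm_le_l1norm.
Qed.

(** The topology on matrices is the entrywise one, and the norm is the sum of
    finitely many moduli of entries. *)
Lemma nbhs_l1norm m n (M : 'M[C]_(m, n)) (B : set 'M[C]_(m, n)) :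
  nbhs M B <-> exists2 eps : R, 0 < eps & forall N, l1norm (M - N) < eps -> B N.
Proof.
split=> [/nbhs_ballP[e e_gt0 eB]|[eps eps_gt0 epsB]].
  have eE : e = (complex.Re e)%:C%C by rewrite RRe_real // gtr0_real.
  exists (complex.Re e) => [|N MN]; first by rewrite -ltcR -eE.
  apply: eB; split=> // i j; rewrite /ball /= cnormE eE ltcR.
  by apply: le_lt_trans MN; have := cnorm_le_l1norm (M - N) i j; rewrite !mxE.
pose k : R := (m * n)%:R + 1; have k_gt0 : 0 < k by rewrite ltr_wpDl.
apply/nbhs_ballP; exists (eps / k)%:C%C; first by rewrite /= ltcR divr_gt0.
move=> N [_ MN]; apply: epsB; apply: (@le_lt_trans _ _ (\sum_(i < m) \sum_(j < n) (eps / k))).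
  apply: ler_sum => i _; apply: ler_sum => j _.
  by have := MN i j; rewrite /ball /= cnormE ltcR !mxE => /ltW.
rewrite !sumr_const !card_ord -mulrnA mulnC -mulr_natl mulrA ltr_pdivrMr //.
by rewrite mulrC ltr_pM2l // /k ltrDl.
Qed.

Lemma open_l1norm_ball m n (M : 'M[C]_(m, n)) (eps : R) : open [set N | l1norm (M - N) < eps].
Proof.
rewrite openE => N /= MN; apply/nbhs_l1norm; exists (eps - l1norm (M - N)).
  by rewrite subr_gt0.
move=> N' NN'; rewrite /= (_ : M - N' = (M - N) + (N - N')); last by rewrite addrA subrK.
by rewrite (le_lt_trans (l1normD _ _)) // addrC -ltrBrDr.
Qed.

Lemma le0_geometric (x D : R) : (forall k, x <= D / 2 ^+ k) -> x <= 0.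
Proof.
move=> xD; rewrite leNgt; apply/negP => x_gt0.
have D_ge0 : 0 <= D by rewrite (le_trans (ltW x_gt0)) // -[D]divr1 -[1](expr0 2) xD.
have := xD (Num.bound (D / x)); rewrite leNgt => /negP[].
rewrite ltr_pdivrMr ?exprn_gt0 // mulrC -ltr_pdivrMr //.
apply: lt_trans (archi_boundP _) _; first by rewrite divr_ge0 // ltW.
by rewrite -natrX ltr_nat ltn_expl.
Qed.

(** The lower ends of the nested intervals a k +- 2 D / 2 ^ k increase, and
    their supremum is the limit. *)
Lemma real_geometric_limit (a : nat -> R) (D : R) :
  (forall k, `|a k.+1 - a k| <= D / 2 ^+ k) ->
  exists l, forall k, `|a k - l| <= 2 * D / 2 ^+ k.
Proof.
move=> aD; pose lo k := a k - 2 * D / 2 ^+ k; pose hi k := a k + 2 * D / 2 ^+ k.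
have D_ge0 : 0 <= D by rewrite (le_trans (normr_ge0 _) (le_trans (aD 0%N) _)) // expr0 divr1.
have halfE k : 2 * D / 2 ^+ k.+1 = D / 2 ^+ k.
  by rewrite exprS invfM mulrACA divff ?mul1r.
have two k : 2 * D / 2 ^+ k = D / 2 ^+ k + D / 2 ^+ k by rewrite -mulrA mulr_natl mulr2n.
have loS k : lo k <= lo k.+1.
  by have := aD k; rewrite /lo halfE two ler_norml => /andP[]; lra.
have hiS k : hi k.+1 <= hi k.
  by have := aD k; rewrite /hi halfE two ler_norml => /andP[]; lra.
have lo_mono : {homo lo : i j / (i <= j)%N >-> i <= j}.
  by apply: homo_leq => //; exact: le_trans.
have hi_mono : {homo hi : i j / (i <= j)%N >-> j <= i}.
  by apply: homo_leq => // x y z xy yz; exact: le_trans yz xy.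
have lohi i j : lo i <= hi j.
  rewrite (le_trans (lo_mono i (maxn i j) (leq_maxl _ _))) //.
  rewrite (le_trans _ (hi_mono j (maxn i j) (leq_maxr _ _))) //.
  have : 0 <= 2 * D / 2 ^+ maxn i j by rewrite !mulr_ge0 // invr_ge0 exprn_ge0.
  by rewrite /lo /hi; lra.
have lo_sup : has_sup (range lo).
  by split; [exists (lo 0%N), 0%N | exists (hi 0%N) => _ [k _ <-]].
exists (sup (range lo)) => k; rewrite distrC ler_distl; apply/andP; split.
  by apply: sup_upper_bound => //; exists k.
by apply: ge_sup => [|_ [i _ <-]]; [exists (lo 0%N), 0%N | exact: lohi].
Qed.

Lemma l1norm_geometric_limit m n (u : nat -> 'M[C]_(m, n)) (D : R) :
  (forall k, l1norm (u k.+1 - u k) <= D / 2 ^+ k) ->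
  exists l, exists B : R, forall k, l1norm (u k - l) <= B / 2 ^+ k.
Proof.
move=> uD.
have entry_lim i j : exists l : C, forall k, cnorm (u k i j - l) <= 4 * D / 2 ^+ k.
  have uij k : cnorm (u k.+1 i j - u k i j) <= D / 2 ^+ k.
    by rewrite (le_trans _ (uD k)) //; have := cnorm_le_l1norm (u k.+1 - u k) i j; rewrite !mxE.
  have [x xP] : exists x : R, forall k, `|complex.Re (u k i j) - x| <= 2 * D / 2 ^+ k.
    apply: real_geometric_limit => k; apply: le_trans (uij k).
    by apply: le_trans (Re_le_cnorm _); case: (u k.+1 i j) (u k i j) => ? ? [].
  have [y yP] : exists y : R, forall k, `|complex.Im (u k i j) - y| <= 2 * D / 2 ^+ k.
    apply: real_geometric_limit => k; apply: le_trans (uij k).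
    by apply: le_trans (Im_le_cnorm _); case: (u k.+1 i j) (u k i j) => ? ? [].
  exists (x +i* y)%C => k; apply: le_trans (cnorm_le_ReIm _) _.
  have -> : 4 * D / 2 ^+ k = 2 * D / 2 ^+ k + 2 * D / 2 ^+ k.
    by rewrite -!mulrDl; congr (_ / _); ring.
  by apply: lerD; [apply: le_trans (xP k)|apply: le_trans (yP k)]; case: (u k i j).
have /fin_all_exists[l lP] : forall i, exists l : 'I_n -> C,
    forall j k, cnorm (u k i j - l j) <= 4 * D / 2 ^+ k.
  by move=> i; exact: fin_all_exists (entry_lim i).
exists (\matrix_(i, j) l i j), (\sum_(i < m) \sum_(j < n) (4 * D)) => k.
rewrite /l1norm mulr_suml; apply: ler_sum => i _; rewrite mulr_suml.
by apply: ler_sum => j _; rewrite !mxE lP.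
Qed.

(** Banach's theorem on a ball of a linear subspace: the iterates of 0 converge
    geometrically, and the limit stays in V because V is the kernel of a
    bounded linear map. *)
Lemma contraction_fixpoint m (V : {vspace 'M[C]_m}) (f : 'M[C]_m -> 'M[C]_m) (rho : R) :
    0 <= rho ->
    (forall X, X \in V -> l1norm X <= rho -> f X \in V /\ l1norm (f X) <= rho) ->
    (forall X Y, X \in V -> l1norm X <= rho -> Y \in V -> l1norm Y <= rho ->
       l1norm (f X - f Y) <= 2^-1 * l1norm (X - Y)) ->
  exists X, [/\ X \in V, l1norm X <= rho & f X = X].
Proof.
move=> rho_ge0 f_stab f_contr; pose u k := iter k f 0.
have uV k : u k \in V /\ l1norm (u k) <= rho.
  elim: k => [|k [uV u_le]]; first by rewrite mem0v l1norm0.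
  exact: f_stab.
have uD k : l1norm (u k.+1 - u k) <= rho / 2 ^+ k.
  elim: k => [|k IHk]; first by rewrite subr0 expr0 divr1; case: (uV 1%N).
  have [uV0 u0] := uV k; have [uV1 u1] := uV k.+1.
  rewrite (le_trans (f_contr _ _ uV1 u1 uV0 u0)) // exprS invfM mulrCA.
  by rewrite ler_pM2l // invr_gt0.
have [l [B lP]] := l1norm_geometric_limit uD; exists l.
have lV : l \in V.
  pose F : {linear 'M[C]_m -> 'M[C]_m} := \1%VF - projv V.
  have FV X : X \in V -> F X = 0.
    by move=> XV; rewrite /F /= !lfunE /= lfunE /= lfunE /= projv_id // subrr.
  have [c c_ge1 cP] := l1norm_linear_bounded F.
  suff : F l = 0.
    rewrite /F /= !lfunE /= lfunE /= lfunE /= => /eqP; rewrite subr_eq0 => /eqP ->.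
    exact: memv_proj.
  apply: l1norm_eq0; apply: (@le0_geometric _ (c * B)) => k.
  rewrite -l1normN -[- _]add0r -(FV (u k)); last by case: (uV k).
  by rewrite -linearB (le_trans (cP _)) // -mulrA ler_pM2l // (lt_le_trans ltr01).
have l_le : l1norm l <= rho.
  rewrite -subr_le0; apply: (@le0_geometric _ B) => k.
  have [_ uk] := uV k; rewrite lerBlDr.
  rewrite (_ : l = u k - (u k - l)); last by rewrite opprB addrC subrK.
  by rewrite (le_trans (l1normB _ _)) // addrC lerD.
split=> //; apply/eqP; rewrite -subr_eq0; apply/eqP/l1norm_eq0.
apply: (@le0_geometric _ B) => k; have [ukV uk] := uV k.
rewrite (_ : f l - l = (f l - u k.+1) + (u k.+1 - l)); last by rewrite addrA subrK.
have half : B / 2 ^+ k.+1 = 2^-1 * (B / 2 ^+ k) by rewrite exprS invfM mulrCA.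
rewrite (le_trans (l1normD _ _)) // (_ : B / 2 ^+ k = B / 2 ^+ k.+1 + B / 2 ^+ k.+1); last first.
  by rewrite half; field; rewrite expf_neq0.
apply: lerD (lP k.+1); rewrite half (le_trans (f_contr _ _ lV l_le ukV uk)) //.
by rewrite ler_pM2l ?invr_gt0 // l1normBC lP.
Qed.

End MatrixNorm.

(** * The Cayley transform *)

Section Cayley.
Variables (K : numFieldType) (m : nat).
Implicit Types A P S T : 'M[K]_m.

Definition cayley P : 'M[K]_m := (1%:M + P) *m invmx (1%:M - P).

(** The intertwining relation passes to the inverses; with P = Q it says that A
    commutes with the inverse of P. *)
Lemma intertwine_inv P Q A : P \in unitmx -> Q \in unitmx ->
  A *m Q = P *m A -> invmx P *m A = A *m invmx Q.
Proof.
move=> Pu Qu AQ; apply: (can_inj (mulKmx Pu)); rewrite mulmxA mulmxV // mul1mx.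
by rewrite mulmxA -AQ mulmxK.
Qed.

Lemma cayleyC P : 1%:M - P \in unitmx ->
  cayley P = invmx (1%:M - P) *m (1%:M + P).
Proof.
move=> u; rewrite /cayley (intertwine_inv u u) //.
rewrite mulmxDl mul1mx mulmxBr mulmx1 addrA subrK.
by rewrite mulmxBl mul1mx mulmxDr mulmx1 opprD addrA addrK.
Qed.

Lemma cayleyE P : 1%:M - P \in unitmx -> cayley P = 2 *: invmx (1%:M - P) - 1%:M.
Proof.
move=> u; rewrite /cayley (_ : 1%:M + P = 2 *: 1%:M - (1%:M - P)).
  by rewrite mulmxBl mulmxV // -scalemxAl mul1mx.
by apply/matrixP => i j; rewrite !mxE; ring.
Qed.

Variables (Om P : 'M[K]_m).
Hypotheses (OmS : symplectic_form Om).
Hypotheses (uD : 1%:M + P \in unitmx) (uB : 1%:M - P \in unitmx).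

Lemma cayleyNK : cayley (- P) *m cayley P = 1%:M.
Proof. by rewrite /cayley opprK -mulmxA (mulKmx uD) mulmxV. Qed.

Lemma cayleyKN : cayley P *m cayley (- P) = 1%:M.
Proof. exact: mulmx1C cayleyNK. Qed.

Lemma sadj_cayley : sadj Om P = - P -> sadj Om (cayley P) = cayley (- P).
Proof.
move=> P_sp; rewrite (cayleyC uB) sadjM // sadj_invmx // linearD linearB /=.
by rewrite sadj1 // P_sp /cayley opprK.
Qed.

Lemma cayley_Sp : sadj Om P = - P -> Sp Om (cayley P).
Proof.
have [_ Omu] := OmS; move=> P_sp; have := cayleyNK.
rewrite -(sadj_cayley P_sp) /sadj; move: (cayley P) => g /(congr1 (mulmx Om)).
by rewrite !mulmxA mulmxV // mul1mx mulmx1.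
Qed.

Lemma cayley_anticomm A : P *m A = - (A *m P) ->
  cayley P *m A = A *m cayley (- P).
Proof.
move=> PA; rewrite /cayley opprK -mulmxA (intertwine_inv (Q := 1%:M + P) uB) //.
  by rewrite !mulmxA mulmxDl mulmxBr PA mul1mx mulmx1.
by rewrite mulmxDr mulmxBl mul1mx mulmx1 PA opprK.
Qed.

(** With a = 1 + P, b = 1 - P and u = 1 + P^2, the relation between P and Q
    reads 2 P = u Q = Q u, whence a^2 = u (1 + Q) and b^2 = u (1 - Q). The
    Cayley transforms of P and - P are a^2 and b^2 up to the common factor
    (a b)^-1, so the claim reduces to
    (1 + Q) (T - S) (1 + Q) = - (1 - Q) (S + T) (1 - Q), which expands to the
    equation relating Q, S and T. *)
Lemma cayley_translate_skew S T Q :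
    sadj Om P = - P -> sadj Om S = - S -> sadj Om T = T ->
    Q *m P = P *m Q -> P *+ 2 = Q + Q *m P *m P ->
    anticomm S Q = T + Q *m T *m Q ->
  sadj Om (cayley (- P) *m (S + T) *m cayley (- P))
    = - (cayley (- P) *m (S + T) *m cayley (- P)).
Proof.
move=> P_sp S_sp T_sa QP PQ QS.
have NgE : sadj Om (cayley (- P)) = cayley P.
  by rewrite -(sadj_cayley P_sp) sadjK.
pose a := 1%:M + P; pose b := 1%:M - P.
have [au bu] : a \in unitmx /\ b \in unitmx by [].
have ab : b *m a = a *m b.
  rewrite mulmxDl mul1mx mulNmx {1}/a mulmxDr mulmx1.
  by rewrite /b mulmxBr mulmx1 {1}/a mulmxDl mul1mx; congr (_ - _); rewrite addrC.
pose v := invmx b *m invmx a.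
have vE : v = invmx a *m invmx b.
  by apply: intertwine_inv => //; apply: intertwine_inv.
have gE : cayley P = v *m (a *m a).
  by rewrite (cayleyC uB) /v mulmxA mulmxKV.
have gE' : cayley P = a *m a *m v.
  by rewrite vE /cayley mulmxA mulmxK.
have hE : cayley (- P) = v *m (b *m b).
  by rewrite vE cayleyC ?opprK // mulmxA mulmxKV.
have hE' : cayley (- P) = b *m b *m v.
  by rewrite /v /cayley opprK mulmxA mulmxK.
pose u := 1%:M + P *m P.
have Qu : Q *m u = P *+ 2 by rewrite mulmxDr mulmx1 mulmxA.
have uQ : u *m Q = P *+ 2.
  by rewrite mulmxDl mul1mx -mulmxA -QP mulmxA -QP PQ.
have aa : a *m a = u + P *+ 2.
  rewrite mulmxDl mul1mx mulmxDr mulmx1 /u mulr2n.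
  by move: (P *m P) => PP; apply/matrixP => i j; rewrite !mxE; ring.
have bb : b *m b = u - P *+ 2.
  rewrite mulmxBl mul1mx mulmxBr mulmx1 /u mulr2n.
  by move: (P *m P) => PP; apply/matrixP => i j; rewrite !mxE; ring.
have key : (1%:M + Q) *m (- S + T) *m (1%:M + Q)
    = - ((1%:M - Q) *m (S + T) *m (1%:M - Q)).
  apply/eqP; rewrite -addr_eq0; apply/eqP.
  rewrite !(mulmxDl, mulmxDr, mul1mx, mulmx1, mulNmx, mulmxN).
  move: QS; rewrite /anticomm.
  move: (Q *m S *m Q) (Q *m T *m Q) => QSQ QTQ.
  move: (Q *m S) (Q *m T) (S *m Q) (T *m Q) => QS QT SQ TQ e; apply/matrixP => i j.
  move/matrixP/(_ i j): e; rewrite !mxE => e.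
  by transitivity (2 * (T i j + QTQ i j) - 2 * (QS i j + SQ i j)); [ring | rewrite e; ring].
move: NgE gE gE' hE hE'; move: (cayley P) (cayley (- P)) => g h hg gE gE' hE hE'.
rewrite !sadjM // hg linearD /= S_sp T_sa mulmxA {1}gE gE' {1}hE hE'.
have aaE : a *m a = (1%:M + Q) *m u by rewrite aa mulmxDl mul1mx Qu.
have aaE' : a *m a = u *m (1%:M + Q) by rewrite aa mulmxDr mulmx1 uQ.
have bbE : b *m b = (1%:M - Q) *m u by rewrite bb mulmxBl mul1mx Qu.
have bbE' : b *m b = u *m (1%:M - Q) by rewrite bb mulmxBr mulmx1 uQ.
rewrite {1}aaE' aaE {1}bbE' bbE.
have assoc X W : v *m (u *m X) *m W *m (X *m u *m v) = v *m u *m (X *m W *m X) *m (u *m v).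
  by rewrite !mulmxA.
by rewrite !assoc key mulmxN mulNmx.
Qed.

End Cayley.

(** * Cayley transforms in the identity component of the stabilizer *)

Section BlockAction.
Variables (K : numFieldType) (n : nat) (Om : 'M[K]_n).
Hypothesis OmS : symplectic_form Om.

Lemma Ad_block_diag (g h X Y : 'M[K]_n) : g *m h = 1%:M ->
  Ad (block_mx g 0 0 h) (block_mx 0 X Y 0) = block_mx 0 (g *m X *m g) (h *m Y *m h) 0.
Proof.
move=> gh; have hg := mulmx1C gh.
have gu : block_mx g 0 0 h *m block_mx h 0 0 g = 1%:M.
  by rewrite mulmx_block !(mulmx0, mul0mx, addr0, add0r) gh hg -scalar_mx_block.
have [Gu _] := mulmx1_unit gu.
have -> : Ad (block_mx g 0 0 h) (block_mx 0 X Y 0) =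
    block_mx g 0 0 h *m block_mx 0 X Y 0 *m block_mx h 0 0 g.
  by rewrite /Ad; congr (_ *m _); rewrite -[RHS](mulKmx Gu) gu mulmx1.
by rewrite !mulmx_block !(mulmx0, mul0mx, addr0, add0r).
Qed.

(** As P anticommutes with A, the Cayley transform g of P satisfies
    g A = A g^-1, which is what diag(g, g^-1) needs to fix e. *)
Lemma cayley_Hstab A P :
    1%:M + P \in unitmx -> 1%:M - P \in unitmx -> sadj Om P = - P ->
    P *m A = - (A *m P) ->
  Hstab Om (block_mx 0 A A 0) (block_mx (cayley P) 0 0 (cayley (- P))).
Proof.
move=> uD uB P_sp PA; have uD' : 1%:M + - P \in unitmx by [].
have uB' : 1%:M - - P \in unitmx by rewrite opprK.
have P_sp' : sadj Om (- P) = - - P by rewrite linearN /= P_sp.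
have PA' : - P *m A = - (A *m - P) by rewrite mulNmx mulmxN PA.
split.
  exists (cayley P); first exact: cayley_Sp.
  by exists (cayley (- P)) => //; exact: cayley_Sp.
rewrite Ad_block_diag ?cayleyKN // !cayley_anticomm // opprK.
by rewrite -!(mulmxA A) cayleyKN // cayleyNK // !mulmx1.
Qed.

End BlockAction.

Section CayleyPath.
Variables (R : realType) (n : nat).
Local Notation C := (Cplx R).
Implicit Types X Y P : 'M[C]_n.

Lemma unitmx_subr_small X : l1norm X < 1 -> 1%:M - X \in unitmx.
Proof.
move=> X_lt1; rewrite -row_free_unit -kermx_eq0; apply/eqP/l1norm_eq0.
set N := kermx _; have NX : N *m X = N.
  have /eqP := mulmx_ker (1%:M - X).
  by rewrite -/N mulmxBr mulmx1 subr_eq0 eq_sym => /eqP.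
have : l1norm N <= l1norm N * l1norm X by rewrite -{1}NX l1normM.
have := l1norm_ge0 N; nra.
Qed.

(** The inverse Y satisfies Y = 1 + X Y. *)
Lemma l1norm_inv_subr X : l1norm X <= 2^-1 ->
  l1norm (invmx (1%:M - X)) <= 2 * l1norm (1%:M : 'M[C]_n).
Proof.
move=> X_le; have u : 1%:M - X \in unitmx by apply: unitmx_subr_small; lra.
set Y := invmx _; have YE : Y = 1%:M + X *m Y.
  have : (1%:M - X) *m Y = 1%:M by rewrite mulmxV.
  by rewrite mulmxBl mul1mx => /eqP; rewrite subr_eq => /eqP.
have : l1norm Y <= l1norm (1%:M : 'M[C]_n) + l1norm X * l1norm Y.
  by rewrite {1}YE (le_trans (l1normD _ _)) // lerD2l l1normM.
have := l1norm_ge0 Y; nra.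
Qed.

(** The Cayley transform is 2 (1 - X)^-1 - 1, and the difference of two
    inverses is controlled by the resolvent identity. *)
Lemma cayley_lipschitz : exists2 L : R, 0 < L & forall X Y,
  l1norm X <= 2^-1 -> l1norm Y <= 2^-1 -> l1norm (cayley X - cayley Y) <= L * l1norm (X - Y).
Proof.
pose c := 2 * l1norm (1%:M : 'M[C]_n); exists (cnorm 2 * c * c + 1) => [|X Y X_le Y_le].
  have := cnorm_ge0 (2 : C); have := l1norm_ge0 (1%:M : 'M[C]_n); rewrite /c; nra.
have uX : 1%:M - X \in unitmx by apply: unitmx_subr_small; lra.
have uY : 1%:M - Y \in unitmx by apply: unitmx_subr_small; lra.
have -> : cayley X - cayley Y =
    2 *: (invmx (1%:M - X) *m (X - Y) *m invmx (1%:M - Y)).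
  have -> : X - Y = (1%:M - Y) - (1%:M - X) by apply/matrixP => i j; rewrite !mxE; ring.
  rewrite mulmxBr mulVmx // mulmxBl mul1mx mulmxK // !cayleyE // scalerBr.
  by rewrite opprB addrA addrNK.
have nX := l1norm_inv_subr X_le; have nY := l1norm_inv_subr Y_le.
have le_prod : l1norm (invmx (1%:M - X) *m (X - Y) *m invmx (1%:M - Y)) <= c * c * l1norm (X - Y).
  rewrite mulrAC (le_trans (l1normM _ _)) // ler_pM ?l1norm_ge0 //.
  by rewrite (le_trans (l1normM _ _)) // ler_wpM2r ?l1norm_ge0.
rewrite l1normZ mulrDl mul1r -[leLHS]addr0 lerD ?l1norm_ge0 // -!mulrA ler_wpM2l ?cnorm_ge0 //.
by rewrite (le_trans le_prod) // /c !mulrA.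
Qed.

(** The path of the Cayley transforms of t P, for t in [0, 1], starts at 1 and
    stays in the stabilizer. *)
Lemma cayley_Hstab0 (Om : 'M[C]_n) A P : symplectic_form Om ->
    l1norm P <= 2^-1 -> sadj Om P = - P -> P *m A = - (A *m P) ->
  Hstab0 Om (block_mx 0 A A 0) (block_mx (cayley P) 0 0 (cayley (- P))).
Proof.
move=> OmS P_le P_sp PA.
pose f (t : R) := block_mx (cayley (t%:C%C *: P)) 0 0 (cayley (- (t%:C%C *: P))).
have tP_le t : `[0, 1]%classic t -> l1norm (t%:C%C *: P) <= 2^-1.
  rewrite /= in_itv /= => /andP[t0 t1]; rewrite l1normZ cnorm_real ger0_norm //.
  by have := l1norm_ge0 P; nra.
have fH : f @` `[0, 1] `<=` Hstab Om (block_mx 0 A A 0).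
  move=> _ [t /tP_le tP <-]; apply: cayley_Hstab => //.
  - by rewrite -[_ *: P]opprK; apply: unitmx_subr_small; rewrite l1normN; lra.
  - by apply: unitmx_subr_small; lra.
  - by rewrite linearZ /= P_sp scalerN.
  - by rewrite -scalemxAl PA scalerN scalemxAr.
have f0 : f 0 = 1%:M.
  rewrite /f scale0r oppr0 cayleyE ?subr0 ?unitmx1 // invmx1.
  by rewrite scaler_nat mulr2n addrK -scalar_mx_block.
have <- : f 1 = block_mx (cayley P) 0 0 (cayley (- P)) by rewrite /f scale1r.
apply: (connected_component_max (B := f @` `[0, 1])) => //; last first.
- by exists 1 => //=; rewrite in_itv /= lexx ler01.
- apply: connected_continuous_connected; first exact: segment_connected.
  apply/subspace_continuousP => t t01 B /nbhs_l1norm[eps eps_gt0 epsB].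
  have [L L_gt0 LP] := cayley_lipschitz.
  pose d := eps / (2 * L * (l1norm P + 1)).
  have d_gt0 : 0 < d by rewrite divr_gt0 // !mulr_gt0 // ltr_wpDl ?l1norm_ge0.
  apply/nbhs_ballP; exists d => //= u tu u01; apply: epsB.
  rewrite /f opp_block_mx add_block_mx !oppr0 !addr0 l1norm_block_diag.
  have uE : t%:C%C *: P - u%:C%C *: P = (t - u)%:C%C *: P by rewrite -scalerBl rmorphB.
  have LtP := LP _ _ (tP_le t t01) (tP_le u u01).
  have LuP : l1norm (cayley (- (t%:C%C *: P)) - cayley (- (u%:C%C *: P)))
      <= L * l1norm (t%:C%C *: P - u%:C%C *: P).
    have -> : t%:C%C *: P - u%:C%C *: P = - (- (t%:C%C *: P) - - (u%:C%C *: P)).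
      by rewrite opprB opprK addrC.
    by rewrite l1normN; apply: LP; rewrite l1normN tP_le.
  have tu_lt : `|t - u| * (2 * L * (l1norm P + 1)) < eps.
    by rewrite -ltr_pdivlMr // !mulr_gt0 // ltr_wpDl ?l1norm_ge0.
  apply: le_lt_trans (lerD LtP LuP) _; apply: le_lt_trans tu_lt.
  rewrite uE l1normZ cnorm_real; have P_ge0 := l1norm_ge0 P; have tu_ge0 := normr_ge0 (t - u).
  have -> : L * (`|t - u| * l1norm P) + L * (`|t - u| * l1norm P)
      = `|t - u| * (2 * L * l1norm P) by ring.
  by rewrite ler_wpM2l // ler_wpM2l ?lerDl ?mulr_ge0 // ltW.
- by exists 0 => //=; rewrite in_itv /= lexx ler01.
Qed.

End CayleyPath.

(** * Solving for the Cayley parameter *)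

Lemma lfun_section (K : fieldType) (aT rT : vectType K) (f : 'Hom(aT, rT)) (U : {vspace aT}) :
  exists L : 'Hom(rT, aT), (forall y, L y \in U) /\ {in (f @: U)%VS, cancel L f}.
Proof.
pose g := (f \o projv U)%VF; exists (projv U \o g^-1)%VF; split=> [y|y].
  by rewrite comp_lfunE memv_proj.
move=> /memv_imgP[x xU ->]; rewrite comp_lfunE -[f (projv U _)]comp_lfunE -/g.
apply: limg_lfunVK; rewrite -[in f x](projv_id xU) -comp_lfunE.
by rewrite memv_img ?memvf.
Qed.

Section Solve.
Variables (R : realType) (n : nat).
Local Notation C := (Cplx R).
Implicit Types X Y Z P Q S T : 'M[C]_n.
Variables Om A : 'M[C]_n.
Hypothesis OmS : symplectic_form Om.

Local Notation spA := (sadjv Om true :&: anticommv A)%VS.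
Local Notation saA := (sadjv Om false :&: anticommv A)%VS.

Lemma l1norm_anticomm X Y : l1norm (anticomm X Y) <= 2 * l1norm X * l1norm Y.
Proof.
rewrite (le_trans (l1normD _ _)) //; have := l1normM X Y; have := l1normM Y X; lra.
Qed.

(** This makes P |-> (Q + Q P P) / 2 a map of the commutant of Q in the
    anticommuting part of sp(V) to itself. *)
Lemma sandwich_spA P Q : P \in spA -> Q *m P = P *m Q -> Q \in spA ->
  Q *m P *m P \in spA.
Proof.
rewrite !memv_cap => /andP[/sadjv_spP P_sp /anticommvP PA] QP.
move=> /andP[/sadjv_spP Q_sp /anticommvP QA].
apply/andP; split.
  apply/sadjv_spP; rewrite !sadjM // P_sp Q_sp !(mulmxN, mulNmx) !opprK.
  by rewrite -QP mulmxA -QP.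
have QPA : Q *m P *m A = A *m (Q *m P).
  by rewrite -(mulmxA Q) PA mulmxN (mulmxA Q) QA mulNmx opprK -mulmxA.
by apply/anticommvP; rewrite -(mulmxA (Q *m P)) PA mulmxN (mulmxA (Q *m P)) QPA -mulmxA.
Qed.

Lemma sandwich_saA Q T : Q \in spA -> T \in saA -> Q *m T *m Q \in saA.
Proof.
rewrite !memv_cap => /andP[/sadjv_spP Q_sp /anticommvP QA].
move=> /andP[/sadjv_saP T_sa /anticommvP TA].
apply/andP; split.
  by apply/sadjv_saP; rewrite !sadjM // Q_sp T_sa mulNmx mulmxN mulmxN opprK mulmxA.
have QTA : Q *m T *m A = A *m (Q *m T).
  by rewrite -(mulmxA Q) TA mulmxN (mulmxA Q) QA mulNmx opprK -mulmxA.
by apply/anticommvP; rewrite -(mulmxA (Q *m T)) QA mulmxN (mulmxA (Q *m T)) QTA -mulmxA.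
Qed.

(** The small root of Q = 2 P / (1 + P^2), as the fixed point of
    P |-> (Q + Q P P) / 2. Iterating inside the commutant of Q keeps the
    iterates skew-adjoint. *)
Lemma cayley_half Q : Q \in spA -> l1norm Q <= 4^-1 ->
  exists P, [/\ P \in spA, l1norm P <= 2^-1, Q *m P = P *m Q & P *+ 2 = Q + Q *m P *m P].
Proof.
move=> QU Q_le; pose com X := Q *m X - X *m Q.
have com_lin : linear com.
  move=> c X Y; rewrite /com mulmxDl mulmxDr -scalemxAl -scalemxAr scalerBr.
  by rewrite opprD addrACA.
pose comM := GRing.isLinear.Build C 'M[C]_n _ _ com com_lin.
pose Com : {linear 'M[C]_n -> 'M[C]_n} := HB.pack com comM.
have comP X : reflect (Q *m X = X *m Q) (X \in lker (linfun Com)).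
  by rewrite memv_ker lfunE /= /com subr_eq0; exact: eqP.
have le4 : 4^-1 <= 2^-1 :> R by lra.
have quarter : 0 <= 4^-1 :> R by lra.
pose f P := 2^-1 *: (Q + Q *m P *m P).
have [||P [PV P_le fP]] :=
    @contraction_fixpoint R n (spA :&: lker (linfun Com))%VS f 4^-1 quarter.
- move=> P; rewrite memv_cap => /andP[PU /comP QP] P_le; split.
    rewrite memv_cap memvZ ?memvD ?sandwich_spA //=; apply/comP.
    rewrite /f -scalemxAr -scalemxAl; congr (_ *: _); rewrite mulmxDl mulmxDr.
    have PPQ : P *m P *m Q = Q *m P *m P by rewrite -mulmxA -QP mulmxA -QP.
    by congr (_ + _); rewrite -[in RHS](mulmxA Q P P) -[RHS]mulmxA PPQ.
  rewrite /f l1normZ cnorm_half.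
  have := l1normD Q (Q *m P *m P); have := l1normM3 Q P P.
  have := l1norm_ge0 P; have := l1norm_ge0 Q.
  have : l1norm Q * l1norm P * l1norm P <= 4^-1 * 4^-1 * 4^-1.
    by rewrite !ler_pM ?mulr_ge0 ?l1norm_ge0.
  by lra.
- move=> X Y _ X_le _ Y_le; rewrite /f -scalerBr l1normZ cnorm_half ler_pM2l ?invr_gt0 //.
  have -> : Q + Q *m X *m X - (Q + Q *m Y *m Y) = Q *m (X - Y) *m X + Q *m Y *m (X - Y).
    by rewrite opprD addrACA subrr add0r !(mulmxDr, mulmxDl, mulmxN, mulNmx) addrA addrNK.
  rewrite (le_trans (l1normD _ _)) //.
  have := l1normM3 Q (X - Y) X; have := l1normM3 Q Y (X - Y).
  have : l1norm Q * l1norm (X - Y) * l1norm X <= 4^-1 * l1norm (X - Y) * 4^-1.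
    by rewrite ler_pM ?mulr_ge0 ?l1norm_ge0 // ler_wpM2r ?l1norm_ge0.
  have : l1norm Q * l1norm Y * l1norm (X - Y) <= 4^-1 * 4^-1 * l1norm (X - Y).
    by rewrite ler_wpM2r ?l1norm_ge0 // ler_pM ?l1norm_ge0.
  have := l1norm_ge0 (X - Y); lra.
move: PV; rewrite memv_cap => /andP[PU /comP QP].
exists P; split=> //; first by apply: le_trans le4.
by rewrite -{1}fP /f -scaler_nat scalerA divff ?scale1r // pnatr_eq0.
Qed.

(** With L a linear section of Q |-> Q S0 + S0 Q and Z = S - S0, a fixed point
    of Q |-> L (T + Q T Q - (Q Z + Z Q)) solves the equation, and this map is
    a contraction when T and Z are small. *)
Lemma anticomm_quadratic_near S0 : sadj Om S0 = - S0 -> S0 *m A = A *m S0 ->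
    (linfun (anticomm S0) @: spA = saA)%VS ->
  exists2 d : R, 0 < d & forall S T, sadj Om S = - S -> S *m A = A *m S ->
    T \in saA -> l1norm (S - S0) < d -> l1norm T < d ->
    exists Q, [/\ Q \in spA, l1norm Q <= 4^-1 & anticomm S Q = T + Q *m T *m Q].
Proof.
(* The two numerical bounds behind the choice c d = 1 / 16 below: the ball of
   radius 1 / 4 is preserved, and the contraction ratio is at most 1 / 2. *)
have num1 : 16^-1 * (1 + 4^-1 * 4^-1 + 2 * 4^-1) <= 4^-1 :> R by lra.
have num2 : 16^-1 * (4^-1 + 4^-1 + 2) <= 2^-1 :> R by lra.
move=> S0_sp S0A onto; have [L [LU LK]] := lfun_section (linfun (anticomm S0)) spA.
rewrite onto in LK; have [c c_ge1 cP] := l1norm_linear_bounded L.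
pose d := (16 * c)^-1; have cd : c * d = 16^-1.
  by rewrite /d invfM mulrCA divff ?mulr1 // gt_eqF // (lt_le_trans ltr01).
have c_ge0 : 0 <= c by rewrite (le_trans ler01).
have quarter : 0 <= 4^-1 :> R by rewrite invr_ge0.
have self_map : c * (d + 4^-1 * d * 4^-1 + 2 * d * 4^-1) <= 4^-1.
  have -> : c * (d + 4^-1 * d * 4^-1 + 2 * d * 4^-1)
      = c * d * (1 + 4^-1 * 4^-1 + 2 * 4^-1) by ring.
  by rewrite cd.
have contracts x : 0 <= x ->
    c * (x * d * 4^-1 + 4^-1 * d * x + 2 * d * x) <= 2^-1 * x.
  move=> x_ge0; have -> : c * (x * d * 4^-1 + 4^-1 * d * x + 2 * d * x)
      = c * d * (4^-1 + 4^-1 + 2) * x by ring.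
  by rewrite cd ler_wpM2r.
have d_gt0 : 0 < d by rewrite invr_gt0 mulr_gt0 // (lt_le_trans ltr01).
exists d => // S T S_sp SA T_sa /ltW S_near /ltW T_small.
pose Z := S - S0; rewrite -/Z in S_near.
pose f Q := L (T + Q *m T *m Q - anticomm Z Q).
have [||Q [QU Q_le fQ]] := @contraction_fixpoint R n spA f 4^-1 quarter.
- move=> Q _ Q_le; split; first exact: LU.
  have QTQ_le : l1norm (Q *m T *m Q) <= 4^-1 * d * 4^-1.
    by rewrite (le_trans (l1normM3 _ _ _)) // !ler_pM ?mulr_ge0 ?l1norm_ge0.
  have ZQ_le : l1norm (anticomm Z Q) <= 2 * d * 4^-1.
    by rewrite (le_trans (l1norm_anticomm _ _)) // ler_pM ?mulr_ge0 ?l1norm_ge0 // ler_wpM2l.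
  apply: le_trans (cP _) (le_trans (ler_wpM2l c_ge0 _) self_map).
  exact: le_trans (l1normB _ _) (lerD (le_trans (l1normD _ _) (lerD T_small QTQ_le)) ZQ_le).
- move=> X Y _ X_le _ Y_le; rewrite /f -linearB (le_trans (cP _)) //.
  have -> : T + X *m T *m X - anticomm Z X - (T + Y *m T *m Y - anticomm Z Y) =
      (X - Y) *m T *m X + Y *m T *m (X - Y) - anticomm Z (X - Y).
    have -> : anticomm Z (X - Y) = anticomm Z X - anticomm Z Y by exact: linearB.
    rewrite !(mulmxBr, mulmxBl); apply/matrixP => i j.
    move: (anticomm Z X) (anticomm Z Y) (X *m T *m X) (Y *m T *m X) (Y *m T *m Y) => *.
    by rewrite !mxE; ring.
  set D := X - Y.
  have DTX_le : l1norm (D *m T *m X) <= l1norm D * d * 4^-1.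
    rewrite (le_trans (l1normM3 _ _ _)) // ler_pM ?mulr_ge0 ?l1norm_ge0 //.
    by rewrite ler_wpM2l ?l1norm_ge0.
  have YTD_le : l1norm (Y *m T *m D) <= 4^-1 * d * l1norm D.
    by rewrite (le_trans (l1normM3 _ _ _)) // ler_wpM2r ?l1norm_ge0 // ler_pM ?l1norm_ge0.
  have ZD_le : l1norm (anticomm Z D) <= 2 * d * l1norm D.
    by rewrite (le_trans (l1norm_anticomm _ _)) // ler_wpM2r ?l1norm_ge0 // ler_wpM2l.
  apply: le_trans (ler_wpM2l c_ge0 _) (contracts _ (l1norm_ge0 D)).
  exact: le_trans (l1normB _ _) (lerD (le_trans (l1normD _ _) (lerD DTX_le YTD_le)) ZD_le).
exists Q; split; [exact: QU | exact: Q_le |].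
have Z_sp : sadj Om Z = - Z by rewrite linearB /= S_sp S0_sp opprD.
have ZA : Z *m A = A *m Z by rewrite mulmxBl mulmxBr SA S0A.
have ZQ_sa : anticomm Z Q \in saA.
  move: QU; rewrite memv_cap => /andP[Q_sp QA].
  rewrite memv_cap; apply/andP; split; last exact: anticomm_anticommv.
  exact: (anticomm_sadjv OmS Z_sp Q_sp).
have arg_sa := memvB (memvD T_sa (sandwich_saA QU T_sa)) ZQ_sa.
have SQE : anticomm S Q = anticomm S0 Q + anticomm Z Q.
  have SE : S = S0 + Z by rewrite addrC subrK.
  by rewrite /anticomm addrACA -mulmxDr -mulmxDl -SE.
have := LK _ arg_sa; rewrite -/(f Q) fQ lfunE /= => S0Q.
by rewrite SQE S0Q subrK.
Qed.

End Solve.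

(** * Linear subspaces in the Zariski topology *)

Section Zariski.
Variables (K : numFieldType) (m n : nat).
Implicit Types (W : {vspace 'M[K]_(m, n)}) (p : mpoly.mpoly (m * n) K).

Lemma linear_coord_mxeval (F : {linear 'M[K]_(m, n) -> K}) :
  exists p, forall X, mxeval X p = F X.
Proof.
exists (\sum_k F (vec_mx (delta_mx 0 k)) *: mpoly.mpolyX K (mpoly.mnm1 k)) => X.
rewrite /mxeval raddf_sum /= -{2}(mxvecK X) {2}(matrix_sum_delta (mxvec X)) big_ord1.
rewrite !linear_sum; apply: eq_bigr => k _.
by rewrite mpoly.mevalZ mpoly.mevalXU !linearZ /= mulrC.
Qed.

(** A subspace is the kernel of the complementary projection, whose entries are
    linear polynomials. *)
Lemma vspace_zariski_closed W : zariski_closed [set X | X \in W].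
Proof.
pose F := (\1 - projv W)%VF.
have FE X : X \in W <-> F X = 0.
  rewrite add_lfunE opp_lfunE id_lfunE; split=> [XW|/eqP].
    by rewrite projv_id // subrr.
  by rewrite subr_eq0 => /eqP ->; exact: memv_proj.
exists [set p | forall X, X \in W -> mxeval X p = 0].
apply/seteqP; split=> [X XW p|X Xp]; first exact.
apply/FE/matrixP => i j; rewrite [RHS]mxE.
have co_lin : linear (fun Y => (F Y) i j : K).
  by move=> c Y Z; rewrite linearP !mxE.
pose coM := GRing.isLinear.Build K 'M[K]_(m, n) _ _ (fun Y => (F Y) i j) co_lin.
pose co : {linear 'M[K]_(m, n) -> K} := HB.pack (fun Y => (F Y) i j) coM.
have [p pE] := linear_coord_mxeval co.
have -> : (F X) i j = mxeval X p by rewrite pE.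
by apply: Xp => Y YW; rewrite pE /= (FE Y).1 // mxE.
Qed.

Lemma mxeval_line p (X D : 'M[K]_(m, n)) :
  exists q : {poly K}, forall t, mxeval (X + t *: D) p = q.[t].
Proof.
exists (\sum_(e <- mpoly.msupp p) mpoly.mcoeff e p *:
  \prod_i ((mxvec X 0 i)%:P + mxvec D 0 i *: 'X) ^+ (mpoly.fun_of_multinom e i)) => t.
rewrite /mxeval mpoly.mevalE horner_sum; apply: eq_bigr => e _.
rewrite hornerZ horner_prod; congr (_ * _); apply: eq_bigr => i _.
by rewrite horner_exp hornerD hornerC hornerZ hornerX linearD linearZ !mxE mulrC.
Qed.

End Zariski.

(** On the line through X0 and X the polynomial has infinitely many zeros, close
    to X0. *)
Lemma mxeval_vanish (R : realType) (m n : nat) (W : {vspace 'M[Cplx R]_(m, n)})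
    (p : mpoly.mpoly (m * n) (Cplx R)) (X0 : 'M[Cplx R]_(m, n)) (d : R) :
    X0 \in W -> 0 < d ->
    (forall X, X \in W -> l1norm (X0 - X) < d -> mxeval X p = 0) ->
  forall X, X \in W -> mxeval X p = 0.
Proof.
move=> X0W d_gt0 p0 X XW; have [q qE] := mxeval_line p X0 (X - X0).
have -> : mxeval X p = q.[1] by rewrite -qE scale1r addrC subrK.
suff -> : q = 0 by rewrite horner0.
pose k := l1norm (X - X0) + 1; have k_gt0 : 0 < k by rewrite ltr_wpDl ?l1norm_ge0.
pose t (i : nat) : R := d / k / i.+1%:R.
(* The points X0 + t i *: (X - X0) are distinct and at distance less than d
   from X0. *)
have t_gt0 i : 0 < t i by rewrite !divr_gt0.
apply: (@roots_geq_poly_eq0 _ _ [seq (t i)%:C%C | i <- iota 0 (size q)]).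
- apply/allP => _ /mapP[i _ ->]; rewrite /root -qE p0 //.
    by rewrite memvD // memvZ // memvB.
  rewrite opprD addrA subrr add0r l1normN l1normZ cnorm_real gtr0_norm //.
  rewrite /t -mulrA -mulrA gtr_pMr // ltr_pdivrMl // mulr1.
  apply: (@le_lt_trans _ _ (l1norm (X - X0))); last by rewrite ltrDl.
  by rewrite ler_piMl ?l1norm_ge0 // invf_le1 // ler1n.
- rewrite map_inj_uniq ?iota_uniq // => i j /complexI.
  rewrite /t => /(mulfI _)/invr_inj/eqP; rewrite eqr_nat eqSS => /(_ _)/eqP; apply.
  by rewrite gt_eqF // divr_gt0.
- by rewrite size_map size_iota.
Qed.

(** * The centralizer of e in p *)

Section Centralizer.
Variables (K : numFieldType) (n : nat) (Om A : 'M[K]_n).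
Hypothesis OmS : symplectic_form Om.
Local Notation e := (block_mx 0 A A 0).

Lemma pp_pmx C : pp Om (pmx Om C).
Proof. by rewrite ppE //; exists C. Qed.

Lemma pmx_comm C : C *m A = - (A *m sadj Om C) -> sadj Om C *m A = - (A *m C) ->
  pcent Om e (pmx Om C).
Proof.
move=> CA C'A; split; first exact: pp_pmx.
rewrite /pmx !mulmx_block !(mulmx0, mul0mx, addr0, add0r, mulNmx, mulmxN).
by rewrite CA C'A opprK subrr.
Qed.

Lemma pcent_pmx x : pcent Om e x ->
  exists C, [/\ x = pmx Om C, C *m A = - (A *m sadj Om C) & sadj Om C *m A = - (A *m C)].
Proof.
rewrite /pcent /= ppE // => -[[C _ <-]] xe; exists C; split=> //.
all: move: xe; rewrite /pmx !mulmx_block !(mulmx0, mul0mx, addr0, add0r, mulNmx, mulmxN).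
all: move/eqP; rewrite subr_eq0 => /eqP/eq_block_mx[CA _ _ C'A] //.
by rewrite -C'A opprK.
Qed.

Lemma pmx_pcent_tau S : sadj Om S = - S -> S *m A = A *m S ->
  pcent_tau Om e (pmx Om S).
Proof.
move=> S_sp SA; split; last by rewrite Ad_block_swap // S_sp opprK.
by apply: pmx_comm; rewrite S_sp ?mulmxN ?mulNmx SA ?opprK.
Qed.

(** The translate of x_(S + T) by diag(h, g), with h = g^-1, has the block
    h (S + T) h; being skew-adjoint, it is tau-fixed. *)
Lemma tau_fixed_translate (S T g h : 'M[K]_n) :
    g *m h = 1%:M -> g *m A = A *m h -> sadj Om h = g ->
    sadj Om S = - S -> S *m A = A *m S -> sadj Om T = T -> T *m A = - (A *m T) ->
    sadj Om (h *m (S + T) *m h) = - (h *m (S + T) *m h) ->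
  exists2 x, pcent_tau Om e x & Ad (block_mx g 0 0 h) x = pmx Om (S + T).
Proof.
move=> gh gA h_adj S_sp SA T_sa TA skew; have hg := mulmx1C gh.
have hA : h *m A = A *m g.
  by rewrite -[LHS]mulmx1 -hg mulmxA -(mulmxA h A) -gA mulmxA hg mul1mx.
have ST_adj : sadj Om (S + T) = - (S - T) by rewrite linearD /= S_sp T_sa opprB addrC.
have C_adj : sadj Om (h *m (S + T) *m h) = - (g *m (S - T) *m g).
  by rewrite !sadjM // h_adj ST_adj mulmxA mulmxN mulNmx.
have CE : h *m (S + T) *m h = g *m (S - T) *m g.
  by apply: oppr_inj; rewrite -skew.
exists (pmx Om (h *m (S + T) *m h)).
  apply: pmx_pcent_tau => //.
  have STA : (S + T) *m A = A *m (S - T) by rewrite mulmxDl SA TA mulmxBr.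
  by rewrite -mulmxA hA mulmxA -(mulmxA h) STA mulmxA hA CE !mulmxA.
rewrite /pmx Ad_block_diag // C_adj ST_adj opprK; congr block_mx.
  by rewrite !mulmxA gh mul1mx -mulmxA hg mulmx1.
by rewrite !mulmxA hg mul1mx -mulmxA gh mulmx1 opprK.
Qed.

(** An element of H acts on x_C by C |-> g C (adj g'), which keeps the shape of
    x_C, and conjugation by a stabilizer of e preserves commuting with e. *)
Lemma Ad_Hstab_pcent h x : Hstab Om e h -> pcent Om e x -> pcent Om e (Ad h x).
Proof.
move=> [[g g_Sp [g' g'_Sp hE]] he] [x_p xe].
have [_ Omu] := OmS.
have adjK k : Sp Om k -> sadj Om k *m k = 1%:M.
  by move=> k_Sp; rewrite /sadj -!mulmxA (mulmxA k^T) k_Sp mulVmx.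
have hi : block_mx (sadj Om g) 0 0 (sadj Om g') *m h = 1%:M.
  by rewrite -hE mulmx_block !(mulmx0, mul0mx, addr0, add0r) !adjK // -scalar_mx_block.
have hi' := mulmx1C hi; have [hu _] := mulmx1_unit hi'.
have hV : invmx h = block_mx (sadj Om g) 0 0 (sadj Om g').
  by rewrite -[RHS](mulKmx hu) hi' mulmx1.
split.
  move: x_p; rewrite ppE // => -[C _ <-]; exists (g *m C *m sadj Om g') => //.
  rewrite /Ad hV -hE /pmx !mulmx_block !(mulmx0, mul0mx, addr0, add0r).
  by rewrite (sadjM OmS (g *m C)) sadjK // (sadjM OmS g) !mulmxN !mulNmx !mulmxA.
rewrite -{2}he -{1}he /Ad !mulmxA !(mulmxKV hu) -!(mulmxA h) -mulmxBr -mulmxBl.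
by rewrite xe mul0mx mulmx0.
Qed.

Lemma tau_sweep_sub_pcent : tau_sweep Om e `<=` pcent Om e.
Proof.
move=> _ [h /connected_component_sub h_stab [x [x_cent _] <-]].
exact: Ad_Hstab_pcent.
Qed.

Lemma pcent_vspace (f : 'M[K]_(n + n)) :
  exists W : {vspace 'M[K]_(n + n)}, pcent Om f = [set x | x \in W].
Proof.
pose F1 x := Ad (invol K n) x + x.
have F1_lin : linear F1.
  move=> c x y; rewrite /F1 /Ad mulmxDr mulmxDl -scalemxAr -scalemxAl scalerDr.
  by rewrite addrACA.
pose F2 x := x *m f - f *m x.
have F2_lin : linear F2.
  move=> c x y; rewrite /F2 mulmxDl mulmxDr -scalemxAl -scalemxAr scalerBr.
  by rewrite opprD addrACA.
pose M1 := GRing.isLinear.Build K 'M[K]_(n + n) _ _ F1 F1_lin.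
pose L1 : {linear 'M[K]_(n + n) -> 'M[K]_(n + n)} := HB.pack F1 M1.
pose M2 := GRing.isLinear.Build K 'M[K]_(n + n) _ _ F2 F2_lin.
pose L2 : {linear 'M[K]_(n + n) -> 'M[K]_(n + n)} := HB.pack F2 M2.
exists (sadjv (sumform Om) true :&: lker (linfun L1) :&: lker (linfun L2))%VS.
have L1E x : (x \in lker (linfun L1)) = (F1 x == 0) by rewrite memv_ker lfunE.
have L2E x : (x \in lker (linfun L2)) = (F2 x == 0) by rewrite memv_ker lfunE.
apply/seteqP; split=> x /=; rewrite 2!memv_cap L1E L2E /F1 /F2.
  move=> [[x_sp x_inv] xf]; rewrite x_inv addNr xf eqxx !andbT.
  exact/sadjv_spP.
move=> /andP[/andP[/sadjv_spP x_sp]].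
by rewrite addr_eq0 => /eqP x_inv /eqP xf.
Qed.

End Centralizer.

(** * The sweep of the tau-fixed part *)

Lemma tau_sweep_cayley (R : realType) (n : nat) (Om A S T Q : 'M[Cplx R]_n) :
    symplectic_form Om -> sadj Om S = - S -> S *m A = A *m S ->
    T \in (sadjv Om false :&: anticommv A)%VS -> Q \in (sadjv Om true :&: anticommv A)%VS ->
    l1norm Q <= 4^-1 -> anticomm S Q = T + Q *m T *m Q ->
  tau_sweep Om (block_mx 0 A A 0) (pmx Om (S + T)).
Proof.
move=> OmS S_sp SA T_in Q_in Q_le QS.
have [P [P_in P_le QP PQ]] := cayley_half OmS Q_in Q_le.
move: T_in; rewrite memv_cap => /andP[/sadjv_saP T_sa /anticommvP TA].
move: P_in; rewrite memv_cap => /andP[/sadjv_spP P_sp /anticommvP PA].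
have half_lt1 : 2^-1 < 1 :> R by lra.
have uB : 1%:M - P \in unitmx.
  by apply: unitmx_subr_small; exact: le_lt_trans half_lt1.
have uD : 1%:M + P \in unitmx.
  by rewrite -[P]opprK; apply: unitmx_subr_small; rewrite l1normN; exact: le_lt_trans half_lt1.
have skew := cayley_translate_skew OmS uD uB P_sp S_sp T_sa QP PQ QS.
have stab := cayley_Hstab0 OmS P_le P_sp PA.
have gA := cayley_anticomm uD uB PA.
have gh := cayleyKN uD uB.
have h_adj : sadj Om (cayley (- P)) = cayley P by rewrite -(sadj_cayley OmS uB P_sp) sadjK.
have [x x_tau xE] := tau_fixed_translate OmS gh gA h_adj S_sp SA T_sa TA skew.
by exists (block_mx (cayley P) 0 0 (cayley (- P))) => //; exists x.
Qed.

(** The skew-adjoint and self-adjoint parts of C depend continuously on x_C, so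
    near x_S0 they fall in the range of [anticomm_quadratic_near]. *)
Lemma tau_sweep_open (R : realType) (n : nat) (Om A S0 : 'M[Cplx R]_n) :
    symplectic_form Om -> sadj Om S0 = - S0 -> S0 *m A = A *m S0 ->
    (linfun (anticomm S0) @: (sadjv Om true :&: anticommv A)
      = sadjv Om false :&: anticommv A)%VS ->
  exists2 d : R, 0 < d & forall x, pcent Om (block_mx 0 A A 0) x ->
    l1norm (pmx Om S0 - x) < d -> tau_sweep Om (block_mx 0 A A 0) x.
Proof.
move=> OmS S0_sp S0A onto.
have [d d_gt0 solve] := anticomm_quadratic_near OmS S0_sp S0A onto.
have [c c_ge1 c_adj] := l1norm_linear_bounded (sadj Om).
have c_gt0 : 0 < c by rewrite (lt_le_trans ltr01).
exists (d / c) => [|x x_cent x_near]; first by rewrite divr_gt0.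
have [C [xE CA C'A]] := pcent_pmx OmS x_cent.
pose D := C - S0; have D_near : l1norm D < d / c.
  apply: le_lt_trans x_near; rewrite l1normBC; apply: le_trans (l1norm_ursubmx _).
  by rewrite xE /pmx opp_block_mx add_block_mx block_mxKur.
pose S := 2^-1 *: (C - sadj Om C); pose T := 2^-1 *: (C + sadj Om C).
have half2 (X : 'M[Cplx R]_n) : 2^-1 *: X + 2^-1 *: X = X.
  by rewrite -scalerDl -[RHS]scale1r; congr (_ *: _); field.
have CE : C = S + T by rewrite /S /T -scalerDr addrACA addNr addr0 scalerDr half2.
have adjK := sadjK _ OmS.
have S_sp : sadj Om S = - S by rewrite /S linearZ linearB /= adjK -scalerN opprB.
have T_sa : sadj Om T = T by rewrite /T linearZ linearD /= adjK addrC.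
have SA : S *m A = A *m S.
  by rewrite /S -scalemxAl -scalemxAr mulmxBl mulmxBr CA C'A opprK addrC.
have TA : T *m A = - (A *m T).
  by rewrite /T -scalemxAl -scalemxAr mulmxDl mulmxDr CA C'A -scalerN opprD addrC.
have T_in : T \in (sadjv Om false :&: anticommv A)%VS.
  by rewrite memv_cap; apply/andP; split; [apply/sadjv_saP | apply/anticommvP].
have bound (X Y : 'M[Cplx R]_n) : X = 2^-1 *: Y ->
    l1norm Y <= l1norm D + l1norm (sadj Om D) -> l1norm X < d.
  move=> -> Y_le; rewrite l1normZ cnorm_half ltr_pdivrMl //.
  apply: (@le_lt_trans _ _ (c * l1norm D + c * l1norm D)).
    by apply: le_trans Y_le (lerD _ (c_adj D)); rewrite ler_peMl ?l1norm_ge0.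
  have cD : c * l1norm D < d by rewrite mulrC -ltr_pdivlMr.
  by rewrite [2 * d]mulr_natl mulr2n ltrD.
have D_adj : sadj Om D = sadj Om C + S0 by rewrite /D linearB /= S0_sp opprK.
have S_near : l1norm (S - S0) < d.
  apply: (bound _ (D - sadj Om D)); last exact: l1normB.
  rewrite -[in LHS](half2 S0) -scalerDr -scalerBr D_adj; congr (_ *: _).
  by rewrite /D -[C - S0 - _]addrA -[C - sadj Om C - _]addrA -!opprD addrCA addrA.
have T_small : l1norm T < d.
  apply: (bound _ (D + sadj Om D)); last exact: l1normD.
  by rewrite /T D_adj /D [sadj Om C + S0]addrC addrA subrK.
have [Q [Q_in Q_le QS]] := solve S T S_sp SA T_in S_near T_small.
have := tau_sweep_cayley OmS S_sp SA T_in Q_in Q_le QS.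
by rewrite -CE -xE.
Qed.

Theorem theorem5p15 (R : realType) (r : nat) (r_ge1 : (1 <= r)%N)
    (Om : 'M[Cplx R]_(2 * r)) (Om_symplectic : symplectic_form Om)
    (O : set 'M[Cplx R]_(2 * r + 2 * r)) (O_dist : p_distinguished_orbit Om O)
    (A : 'M[Cplx R]_(2 * r)) (A_sp : sadj Om A = - A)
    (s : nat) (ns : 'I_s -> nat)
    (ns_decr : forall i j : 'I_s, (i < j)%N -> (ns j < ns i)%N)
    (ns_gt0 : forall i, (0 < ns i)%N)
    (ns_even : forall i, ~~ odd (ns i))
    (ns_sum : (\sum_i ns i = 2 * r)%N)
    (A_jordan : nilpotent_jordan_type A ns)
    (e : 'M[Cplx R]_(2 * r + 2 * r)) (eE : e = block_mx 0 A A 0) (e_O : O e) :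
  zariski_closure (tau_sweep Om e) = pcent Om e /\
  exists U : set 'M[Cplx R]_(2 * r + 2 * r),
    [/\ open U, U `&` pcent Om e !=set0 &
        U `&` pcent Om e `<=` tau_sweep Om e].
Proof.
have [S0 [S0_sp S0A onto]] :=
  regular_centralizing_element Om_symplectic A_sp ns_decr ns_gt0 A_jordan.
have [d d_gt0 sweep] := tau_sweep_open Om_symplectic S0_sp S0A onto.
have x0_cent : pcent Om (block_mx 0 A A 0) (pmx Om S0).
  by have [] := pmx_pcent_tau Om_symplectic S0_sp S0A.
rewrite eE; split; last first.
  exists [set x | l1norm (pmx Om S0 - x) < d]; split; first exact: open_l1norm_ball.
    by exists (pmx Om S0); split=> //=; rewrite subrr l1norm0.
  by move=> x [x_near x_cent]; exact: sweep.
have [W WE] := pcent_vspace Om (block_mx 0 A A 0).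
apply/seteqP; split.
  apply: smallest_sub; first by rewrite WE; exact: vspace_zariski_closed.
  exact: tau_sweep_sub_pcent.
move=> x x_cent Z [[I ZE] sweep_Z]; rewrite ZE => p Ip.
have mem_W y : y \in W <-> pcent Om (block_mx 0 A A 0) y by rewrite WE.
apply: (mxeval_vanish (W := W) (X0 := pmx Om S0) _ d_gt0); try exact/mem_W.
move=> y /mem_W y_cent y_near; have := sweep_Z y (sweep y y_cent y_near).
by rewrite ZE; exact.
Qed.
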